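(* Let $(R,\mathfrak m)$ be a commutative Noetherian local ring and let $M$ be a finitely generated $R$-module. Let $R\ltimes M$ be the idealization of $M$ over $R$, regarded as an $R$-module via $a\mapsto(a,0)$. Then $R\ltimes M$ is sequentially Cohen-Macaulay (resp. sequentially generalized Cohen-Macaulay, sequentially $1$-Cohen-Macaulay) as a ring if and only if $R\ltimes M$ is so as an $R$-module, if and only if both $R$ and $M$ are so (as $R$-modules).
   Context: The idealization $R\ltimes M$ is the additive group $R\oplus M$ with multiplication $(a,x)(b,y)=(ab,ay+bx)$; it is a Noetherian local ring with maximal ideal $\mathfrak m\oplus M$ and dimension $\dim(R)$. Let $M$ be a finitely generated module of dimension $d$ over a Noetherian local ring $(R,\mathfrak m)$. For an Artinian $R$-module $A$ put $\dim_R(A)=\dim(R/\operatorname{Ann}_RA)$; the dimension of the zero module (and of the zero ring) is $-1$. Put $\mathfrak a_i(M)=\operatorname{Ann}_RH^i_{\mathfrak m}(M)$ and $\mathfrak a(M)=\mathfrak a_0(M)\cdots\mathfrak a_{d-1}(M)$ (the empty product is $R$). Then $M$ is Cohen-Macaulay (resp. generalized Cohen-Macaulay, $1$-Cohen-Macaulay) if $\dim(R/\mathfrak a(M))=-1$ (resp. $\le 0$, $\le 1$); equivalently, for all $i<d$, $H^i_{\mathfrak m}(M)=0$ (resp. $\dim_R H^i_{\mathfrak m}(M)\le 0$, $\dim_R H^i_{\mathfrak m}(M)\le 1$). The dimension filtration of $M$ is the unique filtration $H^0_{\mathfrak m}(M)=D_t\subset\dots\subset D_1\subset D_0=M$ in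 which, for all $i<t$, $D_{i+1}$ is the largest submodule of $M$ of dimension less than $\dim_R(D_i)$. $M$ is sequentially Cohen-Macaulay (resp. sequentially generalized Cohen-Macaulay, sequentially $1$-Cohen-Macaulay) if each quotient $D_i/D_{i+1}$, $0\le i<t$, is Cohen-Macaulay (resp. generalized Cohen-Macaulay, $1$-Cohen-Macaulay). A local ring has one of these properties ''as a ring'' if it has it as a module over itself. *)

(* Defs.v *)
From HB Require Import structures.
From mathcomp Require Import all_boot all_order all_algebra.
From mathcomp Require Import boolp classical_sets constructive_ereal.

Set Implicit Arguments.
Unset Strict Implicit.
Unset Printing Implicit Defensive.

Import Order.TTheory GRing.Theory Num.Theory.
Local Open Scope ring_scope.
Local Open Scope quotient_scope.

(* Ideals are submodules of [R^o], whereas [idealr R] is the type of proper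
   ideals: the library requires 1 not to belong to them. *)

Section Ideals.
Variable R : comNzRingType.

Definition fin_gen (V : lmodType R) (A : {pred V}) : Prop :=
  exists (n : nat) (g : 'I_n -> V), (forall i, g i \in A) /\
    forall x, x \in A -> exists c : 'I_n -> R, x = \sum_(i < n) c i *: g i.

Definition noetherian_ring : Prop := forall I : submodClosed R^o, fin_gen I.

Definition maximal_ideal (m : idealr R) : Prop :=
  forall J : idealr R, {subset m <= J} -> {subset J <= m}.

Definition local_ring (m : idealr R) : Prop :=
  maximal_ideal m /\ forall m' : idealr R, maximal_ideal m' -> m' =i m.

(* This is the product ideal when [I] and [J] are ideals. *)
Definition idealM (I J : {pred R}) : {pred R} := [pred a | `[< exists s : seq (R * R),
  (forall p, p \in s -> p.1 \in I /\ p.2 \in J) /\ a = \sum_(p <- s) p.1 * p.2 >]].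

Definition idealX (I : {pred R}) (n : nat) : {pred R} := iter n (idealM I) predT.

Definition prime_chain (I : {pred R}) (n : nat) : Prop :=
  exists P : 'I_n.+1 -> prime_idealr R,
    (forall i, {subset I <= P i}) /\
    forall i j : 'I_n.+1, (i < j)%N ->
      {subset P i <= P j} /\ ~ {subset P j <= P i}.

(* The Krull dimension of R/I: the primes of R/I are those of R containing I.
   [supremum x0 A] is [x0] when [A] is empty, so the zero ring gets -1. *)
Definition dim_quot (I : {pred R}) : \bar int :=
  supremum (-1)%:E [set n%:Z%:E | n in prime_chain I].

Definition ann (V : lmodType R) (A : {pred V}) : {pred R} :=
  [pred a | `[< forall x, x \in A -> a *: x = 0 >]].

Definition dim_mod (V : lmodType R) (A : {pred V}) : \bar int := dim_quot (ann A).

End Ideals.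

Section Submodule.
Variables (R : comNzRingType) (V : lmodType R) (A : submodClosed V).

Inductive submodule : Type := Submodule u of u \in A.

Definition sm_val (w : submodule) : V := let: Submodule u _ := w in u.

HB.instance Definition _ := [isSub for sm_val].
HB.instance Definition _ := [Choice of submodule by <:].
HB.instance Definition _ := [SubChoice_isSubLmodule of submodule by <:].

End Submodule.

Section QuotientModule.
Variables (R : comNzRingType) (V : lmodType R) (B : submodClosed V).

(* [submodClosed] does not record closure under opposite. *)
Definition quot_ker : {pred V} := B.
HB.instance Definition _ := GRing.isZmodClosed.Build V quot_ker
  (GRing.subsemimod_closedB (GRing.subsemimodClosedP B)).

Definition quot_module : Type := Quotient.quot quot_ker.
HB.instance Definition _ := ZmodQuotient.on quot_module.

Definition quot_scale (a : R) : quot_module -> quot_module :=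
  lift_op1 quot_module (fun x : V => a *: x).

Lemma pi_quot_scale a : {morph \pi_quot_module : x / a *: x >-> quot_scale a x}.
Proof.
move=> x; unlock quot_scale; apply/eqP; rewrite eqmodE.
rewrite /= Quotient.equivE -scalerBr.
have /rpredZ : x - repr (\pi_quot_module x) \in quot_ker.
  by rewrite Quotient.idealrBE reprK.
exact.
Qed.
Canonical pi_quot_scale_morph a := PiMorph1 (pi_quot_scale a).

Fact quot_scaleA a b x : quot_scale a (quot_scale b x) = quot_scale (a * b) x.
Proof. by rewrite -[x]reprK !piE scalerA. Qed.
Fact quot_scale1 : left_id 1 quot_scale.
Proof. by move=> x; rewrite -[x]reprK !piE scale1r. Qed.
Fact quot_scaleDr : right_distributive quot_scale +%R.
Proof. by move=> a x y; rewrite -[x]reprK -[y]reprK !piE scalerDr. Qed.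
Fact quot_scaleDl x : {morph quot_scale^~ x : a b / a + b}.
Proof. by move=> a b; rewrite -[x]reprK !piE scalerDl. Qed.

HB.instance Definition _ := GRing.Zmodule_isLmodule.Build R quot_module
  quot_scaleA quot_scale1 quot_scaleDr quot_scaleDl.

End QuotientModule.

Section Subquotient.
Variables (R : comNzRingType) (V : lmodType R) (A B : submodClosed V).

Definition sub_in : {pred submodule A} := [pred u | val u \in B].

Fact sub_in_closed : submod_closed sub_in.
Proof.
split=> [|a u v]; rewrite !inE ?rpred0 // => uB vB.
by rewrite rpredD ?rpredZ.
Qed.
HB.instance Definition _ := GRing.isSubmodClosed.Build R _ sub_in sub_in_closed.

(* A / (A ∩ B); it is used only for B contained in A. *)
Definition subquot : lmodType R := quot_module sub_in.

End Subquotient.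

Section Torsion.
Variables (R : comNzRingType) (m : {pred R}) (V : lmodType R).

Definition torsion : {pred V} :=
  [pred x | `[< exists n, forall a, a \in idealX m n -> a *: x = 0 >]].

Lemma idealX_sub n k : {subset idealX m (k + n) <= idealX m n}.
Proof.
have step j : {subset idealX m j.+1 <= idealX m j}.
  elim: j => [//|j IHj] a /asboolP[s [sP ->]]; apply/asboolP; exists s.
  by split=> // p /sP[? ?]; split=> //; apply: IHj.
by elim: k => [//|k IHk] a; rewrite addSn => /step /IHk.
Qed.

Fact torsion_closed : submod_closed torsion.
Proof.
split=> [|a x y /asboolP[n nx] /asboolP[k ky]]; apply/asboolP.
  by exists 0%N => a _; rewrite scaler0.
exists (n + k)%N => b b_in; rewrite scalerDr scalerA mulrC -scalerA.
rewrite nx ?ky ?scaler0 ?addr0 //; last by apply: (@idealX_sub n k); rewrite addnC.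
exact: (@idealX_sub k n).
Qed.
HB.instance Definition _ := GRing.isSubmodClosed.Build R V torsion torsion_closed.

End Torsion.

Arguments torsion {R} m V.

Definition injective_module (R : comNzRingType) (I : lmodType R) : Prop :=
  forall (U V : lmodType R) (f : {linear U -> V}) (g : {linear U -> I}),
    injective f -> exists h : {linear V -> I}, forall u, h (f u) = g u.

Record injective_resolution (R : comNzRingType) (M : lmodType R) : Type := {
  res :> nat -> lmodType R;
  res_aug : {linear M -> res 0};
  res_d : forall n, {linear res n -> res n.+1};
  res_inj : forall n, injective_module (res n);
  res_aug_inj : injective res_aug;
  res_exact0 : forall x, res_d 0 x = 0 <-> exists y, res_aug y = x;
  res_exact : forall n x, res_d n.+1 x = 0 <-> exists y, res_d n y = x
}.

Section LocalCohomology.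
Variables (R : comNzRingType) (m : {pred R}) (M : lmodType R).
Variable I : injective_resolution M.

Definition lc_cycles (i : nat) : {pred I i} :=
  [pred x | (x \in torsion m (I i)) && (res_d I i x == 0)].

Arguments lc_cycles : clear implicits.

Fact lc_cycles_closed i : submod_closed (lc_cycles i).
Proof.
split=> [|a x y /andP[xG /eqP dx] /andP[yG /eqP dy]]; apply/andP; split.
- exact: rpred0.
- by rewrite linear0.
- by rewrite rpredD ?rpredZ.
- by rewrite linearP dx dy scaler0 addr0.
Qed.
HB.instance Definition _ i :=
  GRing.isSubmodClosed.Build R (I i) (lc_cycles i) (lc_cycles_closed i).

Definition lc_boundaries (i : nat) : {pred I i} :=
  match i with
  | 0 => [pred x | x == 0]
  | j.+1 => [pred x | `[< exists y, y \in torsion m (I j) /\ x = res_d I j y >]]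
  end.

Arguments lc_boundaries : clear implicits.

Fact lc_boundaries_closed i : submod_closed (lc_boundaries i).
Proof.
case: i => [|j]; split.
- by rewrite inE.
- by move=> a x y /eqP-> /eqP->; rewrite scaler0 addr0 inE.
- by apply/asboolP; exists 0; rewrite rpred0 linear0.
- move=> a _ _ /asboolP[x [xG ->]] /asboolP[y [yG ->]]; apply/asboolP.
  by exists (a *: x + y); rewrite linearP rpredD ?rpredZ.
Qed.
HB.instance Definition _ i :=
  GRing.isSubmodClosed.Build R (I i) (lc_boundaries i) (lc_boundaries_closed i).

(* H^i_m(M) as a right derived functor: the i-th cohomology of the complex
   of m-torsion submodules of the injective resolution [I]. *)
Definition local_cohomology (i : nat) : lmodType R :=
  subquot (lc_cycles i) (lc_boundaries i).

End LocalCohomology.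

Section CohenMacaulay.
Variables (R : comNzRingType) (m : {pred R}).

(* a_i(M) = Ann H^i_m(M). Injective resolutions exist, and local cohomology does not depend, up to
   isomorphism, on the one chosen, so all of them give the same annihilator. *)
Definition lc_ann (M : lmodType R) (i : nat) : {pred R} :=
  [pred a | `[< forall I : injective_resolution M,
                a \in ann (predT : {pred local_cohomology m I i}) >]].

(* [int_dim M] is the number of i with 0 <= i < dim M, when dim M is finite. *)
Definition int_dim (M : lmodType R) : nat :=
  if dim_mod (predT : {pred M}) is (Posz d)%:E then d else 0.

Definition lc_ann_prod (M : lmodType R) : {pred R} :=
  \big[@idealM R/(predT : {pred R})]_(i < int_dim M) lc_ann M i.

(* For k = -1, 0, 1: Cohen-Macaulay, generalized Cohen-Macaulay, 1-Cohen-Macaulay. *)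
Definition dimCM (k : int) (M : lmodType R) : Prop :=
  (dim_quot (lc_ann_prod M) <= k%:E)%E.

Definition is_largest_lt (M : lmodType R) (d : \bar int) (N : submodClosed M) : Prop :=
  (dim_mod N < d)%E /\
  forall N' : submodClosed M, (dim_mod N' < d)%E -> {subset N' <= N}.

Definition dimension_filtration (M : lmodType R) (t : nat)
    (D : nat -> submodClosed M) : Prop :=
  [/\ D 0 =i predT,
      D t =i torsion m M (* = H^0_m(M) *),
      forall i, (i < t)%N -> {subset D i.+1 <= D i} /\ ~ {subset D i <= D i.+1} &
      forall i, (i < t)%N -> is_largest_lt (dim_mod (D i)) (D i.+1)].

Definition seq_dimCM (k : int) (M : lmodType R) : Prop :=
  exists (t : nat) (D : nat -> submodClosed M),
    dimension_filtration t D /\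
    forall i, (i < t)%N -> dimCM k (subquot (D i) (D i.+1)).

Definition seqCM := seq_dimCM (-1).
Definition seq_generalizedCM := seq_dimCM 0.
Definition seq_1CM := seq_dimCM 1.

End CohenMacaulay.

Definition idealization (R : comNzRingType) (M : lmodType R) : Type := (R * M)%type.

Section Idealization.
Variables (R : comNzRingType) (M : lmodType R).
Local Notation S := (idealization M).

HB.instance Definition _ := GRing.Lmodule.copy S (R^o * M)%type.

Definition idz_one : S := (1, 0).
Definition idz_mul (s t : S) : S := (s.1 * t.1, s.1 *: t.2 + t.1 *: s.2).

Fact idz_mulA : associative idz_mul.
Proof.
move=> [a x] [b y] [c z]; congr (_, _); rewrite /= ?mulrA //.
by rewrite !scalerDr !scalerA addrA (mulrC c a) (mulrC c b).
Qed.
Fact idz_mulC : commutative idz_mul.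
Proof. by move=> [a x] [b y]; rewrite /idz_mul /= mulrC addrC. Qed.
Fact idz_mul1 : left_id idz_one idz_mul.
Proof. by move=> [a x]; rewrite /idz_mul /= mul1r scale1r scaler0 addr0. Qed.
Fact idz_mulDl : left_distributive idz_mul +%R.
Proof.
move=> [a x] [b y] [c z]; congr (_, _); rewrite /= ?mulrDl //.
by rewrite scalerDl scalerDr addrACA.
Qed.
Fact idz_one_neq0 : idz_one != 0.
Proof. by apply/eqP => -[/eqP]; rewrite oner_eq0. Qed.

HB.instance Definition _ := GRing.Zmodule_isComNzRing.Build S
  idz_mulA idz_mulC idz_mul1 idz_mulDl idz_one_neq0.

(* The R-module structure is the one given by the ring map a |-> (a, 0). *)
Lemma idz_scaleE (a : R) (s : S) : a *: s = ((a, 0) : S) * s.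
Proof. by case: s => b y; congr (_, _); rewrite /= scaler0 addr0. Qed.

Definition idz_max (m : {pred R}) : {pred S} := [pred s | s.1 \in m].

Section Max.
Variable m : idealr R.

Fact idz_max_closed : idealr_closed (idz_max m).
Proof.
split=> [||s u v uP vP]; rewrite !inE /= ?rpred0 ?idealr1 //.
by apply: rpredD vP; apply: idealMr.
Qed.
HB.instance Definition _ := isIdealr.Build S (idz_max m) idz_max_closed.

End Max.

Lemma idz_prodE (a b : R) (x y : M) :
  ((a, x) : S) * (b, y) = (a * b, a *: y + b *: x).
Proof. by []. Qed.

Definition idz_contr (J : {pred S}) : {pred R} := [pred a | ((a, 0) : S) \in J].

Section Contr.
Variable J : idealr S.

Fact idz_contr_closed : idealr_closed (idz_contr J).
Proof.
split=> [||a u v]; rewrite !inE.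
- exact: (rpred0 J).
- exact/negbT/(idealr1 J).
move=> uJ vJ; have -> : ((a * u + v, 0) : S) = ((a, 0) : S) * (u, 0) + (v, 0).
  by rewrite idz_prodE !scaler0 addr0; congr (_, _); rewrite /= addr0.
by rewrite rpredD ?idealMr.
Qed.
HB.instance Definition _ := isIdealr.Build R (idz_contr J) idz_contr_closed.

(* J + (0 ⊕ M) *)
Definition idz_sum : {pred S} :=
  [pred s : S | `[< exists x : M, ((s.1, x) : S) \in J >]].

Fact idz_sum_closed : idealr_closed idz_sum.
Proof.
split=> [||[c z] [a x] [b y] /asboolP[x' xJ] /asboolP[y' yJ]].
- by apply/asboolP; exists 0; apply: (rpred0 J).
- apply/asboolP => -[x /(idealMr ((1, - x) : S))].
  rewrite idz_prodE mulr1 !scale1r addrN => J1.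
  by have := idealr1 J; rewrite /= J1.
apply/asboolP; exists (c *: x' + y'); have /= := idealMr ((c, 0) : S) xJ.
by rewrite idz_prodE scaler0 addr0 => cJ; have := rpredD cJ yJ.
Qed.
HB.instance Definition _ := isIdealr.Build S idz_sum idz_sum_closed.

End Contr.

Lemma idz_local (m : idealr R) :
  local_ring m -> local_ring (idz_max m : idealr S).
Proof.
move=> [m_max m_uniq]; split=> [J mJ [a x] axJ | J J_max].
  have mc : {subset m <= idz_contr J} by move=> b bm; apply: mJ.
  apply: (m_max (idz_contr J : idealr R) mc); rewrite inE.
  have xJ : ((0, x) : S) \in J by apply: mJ; rewrite inE /= rpred0.
  have -> : ((a, 0) : S) = (a, x) - (0, x).
    by congr (_, _); rewrite /= ?subr0 ?subrr.
  by rewrite rpredB.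
have JM (a : R) (x y : M) : ((a, x) : S) \in J -> ((a, y) : S) \in J.
  move=> axJ; apply: (J_max (idz_sum J : idealr S)); last by apply/asboolP; exists x.
  by move=> [b z] bzJ; apply/asboolP; exists z.
have c_max : maximal_ideal (idz_contr J : idealr R).
  move=> K cK a aK; rewrite inE; apply: (J_max (idz_max K : idealr S)) => //.
  by move=> [b z] /(JM _ _ 0) bJ; apply: cK.
move=> [a x]; rewrite [RHS]inE /= -(m_uniq _ c_max) [RHS]inE.
by apply/idP/idP; apply: JM.
Qed.

End Idealization.

Arguments idz_max {R} M m.

(* Main.v *)
(** The heart of the matter is that, for a module [N] over [S = R ⋉ M], the
    annihilators over [R] and over [S] of the local cohomology of [N] determine
    each other. Call a module flasque if all its iterated torsion submodules
    surject onto their localizations at single elements. Over a Noetherian ring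
    injective modules are flasque, flasqueness does not depend on the base ring,
    and exact complexes of flasque modules stay exact on torsion. Applied to the
    mapping cone of a chain map from an [S]-injective resolution of [N] to an
    [R]-injective one, this shows that both compute the same annihilators.

    The dimension filtration is read off from the submodules of elements [v] with
    [dim R/ann v <= e] and [dim R/ann v < e]: its subquotients are the nonzero
    quotients of the former by the latter. These submodules commute with direct
    sums, which gives the comparison of [R ⊕ M] with [R] and [M]. They are the same
    over [R] and over [S], because the primes of [S] are the [P ⊕ M]. Each
    condition only concerns the primes containing the annihilators of local
    cohomology. *)

(* Since [dimCM] sees local cohomology only through annihilators, no isomorphism of local cohomology
   modules is constructed: it is enough to follow, along chain maps, when a scalar sends torsion
   cycles to boundaries of torsion elements ([kills_cohomology]). The obstacle is that an injective
   module over [S] need not be injective over [R], so its resolution cannot be fed to the definition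
   over [R]. Flasqueness speaks only of single elements acting, which is why it survives the change
   of ring, and the cone reduces the comparison of two complexes to the exactness of one. Torsion is
   taken along a list of elements so that it can be treated one element at a time. Generators of [m]
   generate in [S] only the ideal m ⊕ mM, not m ⊕ M, but 0 ⊕ M has square zero and so the torsion is
   the same.

   Filtrations of a direct sum and of its summands have different lengths and indices, whereas
   levels with the same bound [e] can be compared directly. The price is that some level quotients
   vanish; they satisfy every condition, but have to be set aside because their dimension is -1
   instead of [e]. *)
Require Import Defs.
From HB Require Import structures.
From mathcomp Require Import all_boot all_order all_algebra.
From mathcomp Require Import boolp classical_sets functions constructive_ereal.

Set Implicit Arguments.
Unset Strict Implicit.
Unset Printing Implicit Defensive.

Import Order.TTheory GRing.Theory Num.Theory.
Local Open Scope ring_scope.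

(** * Submodules, Noetherian rings and torsion *)

Lemma submod_of (R : comNzRingType) (V : lmodType R) (P : V -> Prop) :
    P 0 -> (forall a x y, P x -> P y -> P (a *: x + y)) ->
  exists A : submodClosed V, forall x, (x \in A) <-> P x.
Proof.
move=> P0 PD; pose A : {pred V} := [pred x | `[< P x >]].
have Acl : submod_closed A.
  by split=> [|a x y /asboolP Px /asboolP Py]; apply/asboolP=> //; apply: PD.
pose mA := GRing.isSubmodClosed.Build R V A Acl.
pose A' : submodClosed V := HB.pack A mA.
by exists A' => x; split=> /asboolP.
Qed.

Lemma submodB (R : comNzRingType) (V : lmodType R) (A : submodClosed V) x y :
  x \in A -> y \in A -> x - y \in A.
Proof. by move=> xA yA; rewrite -scaleN1r rpredD // rpredZ. Qed.

Lemma linear_of (R : comNzRingType) (U V : lmodType R) (f : U -> V) :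
    (forall a x y, f (a *: x + y) = a *: f x + f y) ->
  exists g : {linear U -> V}, g =1 f.
Proof.
move=> fL; pose mf := GRing.isLinear.Build R U V *:%R f fL.
pose f' : {linear U -> V} := HB.pack f mf.
by exists f'.
Qed.

Lemma idealr_of (R : comNzRingType) (P : R -> Prop) :
    P 0 -> ~ P 1 -> (forall a x y, P x -> P y -> P (a * x + y)) ->
  exists J : idealr R, forall x, (x \in J) <-> P x.
Proof.
move=> P0 P1 PD; pose A : {pred R} := [pred x | `[< P x >]].
have Acl : idealr_closed A.
  split=> [||a x y /asboolP Px /asboolP Py]; try apply/asboolP=> //.
  exact: PD.
pose mA := isIdealr.Build R A Acl.
pose A' : idealr R := HB.pack A mA.
by exists A' => x; split=> /asboolP.
Qed.

Lemma prime_of (R : comNzRingType) (P : R -> Prop) :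
    P 0 -> ~ P 1 -> (forall a x y, P x -> P y -> P (a * x + y)) ->
    (forall a b, P (a * b) -> P a \/ P b) ->
  exists J : prime_idealr R, forall x, (x \in J) <-> P x.
Proof.
move=> P0 P1 PD PM; pose A : {pred R} := [pred x | `[< P x >]].
have Acl : idealr_closed A.
  split=> [||a x y /asboolP Px /asboolP Py]; try apply/asboolP=> //.
  exact: PD.
have Acl2 : prime_idealr_closed A.
  move=> a b /asboolP /PM [] ?; apply/orP; [left|right]; exact/asboolP.
pose mA := isIdealr.Build R A Acl.
pose mA2 := isPrimeIdealrClosed.Build R A Acl2.
pose A' : prime_idealr R := HB.pack A mA mA2.
by exists A' => x; split=> /asboolP.
Qed.

Lemma regular_scaleE (R : comNzRingType) (a : R) (x : R^o) : a *: x = a * (x : R).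
Proof. by []. Qed.

Lemma idealr_submod (R : comNzRingType) (J : idealr R) :
  exists A : submodClosed R^o, forall x, (x \in A) = (x \in J).
Proof.
have [||A AP] := @submod_of R R^o (fun x => x \in J); first exact: rpred0.
  by move=> a x y xJ yJ; rewrite rpredD //; exact: (@idealMr _ J).
by exists A => x; apply/idP/idP => /AP.
Qed.

Lemma submod_idealr (R : comNzRingType) (A : submodClosed R^o) :
  (1 : R) \notin A -> exists J : idealr R, forall x, (x \in J) = (x \in A).
Proof.
move=> A1; have [|||J JP] := @idealr_of R (fun x => x \in A).
- exact: rpred0.
- exact/negP.
- by move=> a x y xA yA; apply: (@rpredD _ A) => //; apply: (@rpredZ _ _ A).
by exists J => x; apply/idP/idP => /JP.
Qed.

Section Noetherian.
Variables (R : comNzRingType) (hR : noetherian_ring R).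

Lemma noetherian_chain (A : nat -> submodClosed R^o) :
    (forall n, {subset A n <= A n.+1}) ->
  exists N, forall n, {subset A n <= A N}.
Proof.
move=> Ainc.
have Amono n k : {subset A n <= A (k + n)%N}.
  by elim: k => [|k IHk] x xA //; rewrite addSn; apply/Ainc/IHk.
have Amon n k x : (n <= k)%N -> x \in A n -> x \in A k.
  by move=> /subnK <-; apply: Amono.
have [||U UP] := @submod_of R R^o (fun x => exists n, x \in A n).
- by exists 0%N; apply: rpred0.
- move=> a x y [n xn] [k yk]; exists (maxn n k).
  rewrite rpredD ?rpredZ //; first exact: Amon (leq_maxl _ _) xn.
  exact: Amon (leq_maxr _ _) yk.
have [r [g [gU Ug]]] := hR U.
have /choice [N NP] : forall i, exists n, g i \in A n by move=> i; apply/UP.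
exists (\max_(i < r) N i)%N => n x xn.
have /Ug [c ->] : x \in U by apply/UP; exists n.
rewrite rpred_sum // => i _; rewrite rpredZ //.
exact: Amon (leq_bigmax i) (NP i).
Qed.

(** Otherwise a choice function gives every candidate a strictly larger one, and iterating it from
    [A0] contradicts [noetherian_chain]. *)
Lemma noetherian_max (P : submodClosed R^o -> Prop) (A0 : submodClosed R^o) :
  P A0 -> exists A, [/\ P A, {subset A0 <= A} &
    forall B, P B -> {subset A <= B} -> {subset B <= A}].
Proof.
move=> PA0; apply: contrapT => noA.
pose T := {A : submodClosed R^o | P A /\ {subset A0 <= A}}.
have /choice [F FP] : forall A : T, exists B : T,
    {subset sval A <= sval B} /\ ~ {subset sval B <= sval A}.
  move=> [A [PA sA]]; apply: contrapT => noB; apply: noA; exists A; split=> //.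
  move=> B PB AB; apply: contrapT => nBA; apply: noB.
  by exists (exist _ B (conj PB (fun x xA => AB x (sA x xA)))).
pose C n := iter n F (exist _ A0 (conj PA0 (fun x xA => xA))).
have [|N NP] := @noetherian_chain (fun n => sval (C n)).
  by move=> n; apply: (FP (C n)).1.
exact: (FP (C N)).2 (NP N.+1).
Qed.

End Noetherian.

(** For a list generating [m] this is m-torsion. Unlike powers of an ideal, a list can be mapped
    along a ring morphism and treated by induction. *)
Definition tors (R : comNzRingType) (V : lmodType R) (xs : seq R) (v : V) : Prop :=
  forall x, x \in xs -> exists k, x ^+ k *: v = 0.

Section Tors.
Variables (R : comNzRingType) (V : lmodType R).
Implicit Types (xs : seq R) (v w : V).

Lemma tors0 xs : tors xs (0 : V).
Proof. by move=> x _; exists 0%N; rewrite scaler0. Qed.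

Lemma tors_closed xs a v w : tors xs v -> tors xs w -> tors xs (a *: v + w).
Proof.
move=> tv tw x xs_x; have [k kv] := tv x xs_x; have [l lw] := tw x xs_x.
exists (k + l)%N; rewrite scalerDr scalerA mulrC -scalerA.
by rewrite [X in _ *: (X *: v)]exprD mulrC -!scalerA kv exprD -scalerA lw !scaler0 addr0.
Qed.

Lemma torsZ xs a v : tors xs v -> tors xs (a *: v).
Proof. by move=> tv; rewrite -[_ *: _]addr0; apply: tors_closed => //; apply: tors0. Qed.

Lemma torsD xs v w : tors xs v -> tors xs w -> tors xs (v + w).
Proof. by move=> tv; rewrite -[v]scale1r; apply: tors_closed. Qed.

Lemma torsN xs v : tors xs v -> tors xs (- v).
Proof. by rewrite -scaleN1r; apply: torsZ. Qed.

Lemma torsB xs v w : tors xs v -> tors xs w -> tors xs (v - w).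
Proof. by move=> tv /torsN; apply: torsD. Qed.

Lemma tors_cons x xs v : tors (x :: xs) v <-> (exists k, x ^+ k *: v = 0) /\ tors xs v.
Proof.
split=> [tv|[xv tv] y]; last by rewrite inE => /orP[/eqP->//|]; apply: tv.
by split=> [|y ys]; apply: tv; rewrite inE ?eqxx ?ys ?orbT.
Qed.

End Tors.

Lemma tors_linear (R : comNzRingType) (U V : lmodType R) (f : {linear U -> V}) xs u :
  tors xs u -> tors xs (f u).
Proof. by move=> tu x /tu[k ku]; exists k; rewrite -linearZ ku linear0. Qed.

(* Each torsion submodule surjects onto its localization at each [x]. *)
Definition flasque (R : comNzRingType) (V : lmodType R) : Prop :=
  forall (xs : seq R) (x : R) (w : V), tors xs w ->
    exists v k, tors xs v /\ x ^+ k *: (x *: v - w) = 0.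

Lemma flasque_exp (R : comNzRingType) (V : lmodType R) : flasque V ->
  forall (xs : seq R) (x : R) (k : nat) (w : V), tors xs w ->
    exists v l, tors xs v /\ x ^+ l *: (x ^+ k *: v - w) = 0.
Proof.
move=> fV xs x k w tw; have [v [l [tv vl]]] := fV xs (x ^+ k) w tw.
by exists v, (k * l)%N; rewrite exprM.
Qed.

Lemma tors_pair (R : comNzRingType) (U V : lmodType R) (xs : seq R) (u : U) (v : V) :
  tors xs u -> tors xs v -> tors xs ((u, v) : (U * V)%type).
Proof.
move=> tu tv x xs_x; have [k ku] := tu x xs_x; have [l lv] := tv x xs_x.
by exists (k + l)%N; congr pair => /=; [rewrite addnC|];
  rewrite exprD -scalerA ?ku ?lv scaler0.
Qed.

Lemma tors_pairP (R : comNzRingType) (U V : lmodType R) (xs : seq R) (w : (U * V)%type) :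
  tors xs w -> tors xs w.1 /\ tors xs w.2.
Proof. by move=> tw; split=> x /tw[k]; case: w {tw} => u v [? ?]; exists k. Qed.

Lemma flasque_pair (R : comNzRingType) (U V : lmodType R) :
  flasque U -> flasque V -> flasque (U * V)%type.
Proof.
move=> fU fV xs x [u v] /tors_pairP[tu tv].
have [u' [k [tu' ku]]] := fU xs x u tu; have [v' [l [tv' lv]]] := fV xs x v tv.
exists (u', v'), (k + l)%N; split; first exact: tors_pair.
by congr pair => /=; [rewrite addnC|]; rewrite exprD -scalerA ?ku ?lv scaler0.
Qed.

(* A bounded below exact complex of flasque modules remains exact on torsion:
   if [z = d y] is killed by [x ^+ k], then [x ^+ k *: y] is a boundary [d w],
   and [w] can be divided by [x ^+ k] up to torsion, which corrects [y]. *)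
Lemma exact_tors (R : comNzRingType) (K : nat -> lmodType R)
    (d : forall n, {linear K n -> K n.+1}) :
    (forall n, flasque (K n)) ->
    (forall n x, d n.+1 (d n x) = 0) ->
    (forall x, d 0 x = 0 -> x = 0) ->
    (forall n x, d n.+1 x = 0 -> exists y, d n y = x) ->
  forall (xs : seq R) n (z : K n.+1), tors xs z -> d n.+1 z = 0 ->
    exists y, tors xs y /\ d n y = z.
Proof.
move=> fK dd e0 e; elim=> [|x xs IHxs] n z.
  by move=> _ /e[y <-]; exists y.
move=> /tors_cons[[k kz] /IHxs tz] /tz[y [ty dy]].
suff [y' [ty' dy' [l ly']]] : exists y', [/\ tors xs y', d n y' = 0 &
    exists l, x ^+ l *: (y - y') = 0].
  exists (y - y'); rewrite linearB dy dy' subr0; split=> //.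
  by apply/tors_cons; split; [exists l | apply: torsB].
have dky : d n (x ^+ k *: y) = 0 by rewrite linearZ /= dy.
case: n z y dy kz ty dky {tz} => [|n] z y dy kz ty dky.
  exists 0; split; [exact: tors0 | exact: linear0 |].
  by exists k; rewrite subr0; apply: e0.
have [w [tw dw]] := IHxs n _ (torsZ (x ^+ k) ty) dky.
have [v [l [tv vl]]] := flasque_exp (fK n) x k tw.
exists (d n v); split; [exact: tors_linear | exact: dd |].
exists (l + k)%N; rewrite exprD -scalerA scalerBr -dw -linearZ -linearB -linearZ /=.
by rewrite -opprB !linearN /= vl linear0 oppr0.
Qed.

(** * Injective modules over a Noetherian ring are flasque *)

Section InjectiveFlasque.
Variables (R : comNzRingType) (hR : noetherian_ring R).

(* Baer's criterion for [W]; a linear map on the ideal [A] is represented by a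
   function on [R] whose values outside [A] are irrelevant. *)
Definition baer (V : lmodType R) (W : V -> Prop) : Prop :=
  forall (A : submodClosed R^o) (f : R -> V),
    (forall a b c : R, b \in A -> c \in A -> f (a * b + c) = a *: f b + f c) ->
    (forall b : R, b \in A -> W (f b)) ->
  exists v, W v /\ forall b : R, b \in A -> f b = b *: v.

Lemma injective_baer (V : lmodType R) : injective_module V -> baer (fun _ : V => True).
Proof.
move=> iV A f fL _.
have [vA vAE] := @linear_of R (submodule A) R^o val (fun a x y => erefl).
have [g gE] := @linear_of R (submodule A) V (fun u => f (val u))
  (fun a x y => fL a _ _ (valP x) (valP y)).
have [|h hP] := iV _ _ vA g; first by move=> x y; rewrite !vAE => /val_inj.
exists (h 1); split=> // b bA; rewrite -linearZ /= regular_scaleE mulr1.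
by have := hP (Submodule bA); rewrite vAE gE.
Qed.

(* [Γ_x] of an injective module is injective: if [x ^+ K] kills [f A], let [N]
   be maximal with [N ∩ A = ker f]; then [N] contains a power of [x]. *)
Lemma baer_tors (V : lmodType R) (W : V -> Prop) (x : R) : baer W ->
  baer (fun v => W v /\ exists k, x ^+ k *: v = 0).
Proof.
move=> bW A f fL fW.
have f0 : f 0 = 0.
  have := fL (-1) 0 0 (rpred0 _) (rpred0 _).
  by rewrite mulr0 addr0 scaleN1r addNr.
have fZ (a b : R) : b \in A -> f (a * b) = a *: f b.
  by move=> bA; have := fL a b 0 bA (rpred0 _); rewrite addr0 f0 addr0.
have fB (b c : R) : b \in A -> c \in A -> f (b - c) = f b - f c.
  by move=> bA cA; have := fL (-1) c b cA bA; rewrite mulN1r scaleN1r ![- _ + _]addrC.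
have AM (a b : R) : b \in A -> a * b \in A by move=> bA; apply: (@rpredZ _ _ A).
(* One exponent serves all of [A], because the submodules of those [b] with [x ^+ n *: f b = 0] form
   an ascending chain. *)
have [K KP] : exists K, forall b, b \in A -> x ^+ K *: f b = 0.
  have /choice [C CP] : forall n, exists C : submodClosed R^o,
      forall b, b \in C <-> b \in A /\ x ^+ n *: f b = 0.
    move=> n; apply: submod_of => [|a b c [bA bn] [cA cn]].
      by rewrite rpred0 f0 scaler0.
    split; first by rewrite rpredD // AM.
    by rewrite fL // scalerDr cn addr0 scalerA mulrC -scalerA bn scaler0.
  have [|N NP] := noetherian_chain hR (A := C).
    move=> n b /CP[bA bn]; apply/CP; split=> //.
    by rewrite exprS -scalerA bn scaler0.
  exists N => b bA; have [_ [k bk]] := fW b bA.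
  by have /NP/CP[] : b \in C k by apply/CP.
have [||L LP] := @submod_of R R^o (fun b => b \in A /\ f b = 0).
- by rewrite rpred0.
- move=> a b c [bA b0] [cA c0]; split; first by rewrite rpredD // AM.
  by rewrite fL // b0 c0 scaler0 addr0.
have [|N [Nf LN Nmax]] :=
    @noetherian_max R hR (fun N => forall b, b \in N -> b \in A -> f b = 0) L.
  by move=> b /LP[].
have NM (a b : R) : b \in N -> a * b \in N by move=> bN; apply: (@rpredZ _ _ N).
(* The quotients (N : x^n) stabilize at [j]. *)
have [j jP] : exists j, forall n s, x ^+ n * s \in N -> x ^+ j * s \in N.
  have /choice [C CP] : forall n, exists C : submodClosed R^o,
      forall b, b \in C <-> x ^+ n * b \in N.
    move=> n; apply: submod_of => [|a b c bN cN]; first by rewrite mulr0; apply: rpred0.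
    by rewrite mulrDr; apply: rpredD => //; rewrite mulrCA; apply: NM.
  have [|j jP] := noetherian_chain hR (A := C).
    by move=> n b /CP bN; apply/CP; rewrite exprS -mulrA NM.
  by exists j => n s /CP/jP/CP.
have [||B BP] := @submod_of R R^o
    (fun b => exists n s, n \in N /\ b = n + x ^+ j * s).
- by exists 0, 0; rewrite rpred0 mulr0 addr0.
- move=> a _ _ [n [s [nN ->]]] [n' [s' [nN' ->]]].
  exists (a * n + n'), (a * s + s'); split; first by rewrite rpredD // NM.
  rewrite regular_scaleE mulrDr addrACA mulrDr; congr (_ + (_ + _)).
  exact: mulrCA.
(* By maximality it is enough that [f] vanishes on the elements of [A] in N + x^j R. If b = n + x^j
   s is one, then x^K b lies in the kernel of [f], hence in [N], so x^(K+j) s is in [N]; by the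
   choice of [j] already x^j s, and thus [b], is in [N]. *)
have xN : x ^+ j \in N.
  apply: (Nmax B); last by apply/BP; exists 0, 1; rewrite rpred0 mulr1 add0r.
    move=> _ /BP[n [s [nN ->]]] bA; apply: Nf => //; rewrite rpredD //.
    apply: (jP (K + j)%N); rewrite exprD -mulrA.
    have /LN : x ^+ K * (n + x ^+ j * s) \in L.
      by apply/LP; split; [exact: AM | rewrite fZ // KP].
    by rewrite mulrDr => h; have := submodB h (NM (x ^+ K) _ nN); rewrite [_ - _]addrC addKr.
  by move=> b bN; apply/BP; exists b, 0; rewrite bN mulr0 addr0.
(* [f] is extended to A + N by zero on [N], which is consistent because [f] vanishes on the elements
   of [A] in [N]. The vector representing this extension is then killed by x^j, an element of
   [N]. *)
have [||U UP] := @submod_of R R^o (fun b => exists a, a \in A /\ b - a \in N).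
- by exists 0; rewrite rpred0 subr0 rpred0.
- move=> a b c [b' [bA bN]] [c' [cA cN]]; exists (a * b' + c'); split.
    by rewrite rpredD // AM.
  by rewrite regular_scaleE opprD addrACA -mulrBr rpredD // NM.
have /choice [sel selP] : forall b, exists a, b \in U -> a \in A /\ b - a \in N.
  move=> b; have [/UP[a aP]|nbU] := pselect (b \in U); first by exists a.
  by exists 0 => /nbU.
have selE a b : a \in A -> b - a \in N -> f (sel b) = f a.
  move=> aA baN; have [|sA sN] := selP b; first by apply/UP; exists a.
  apply/eqP; rewrite -subr_eq0 -fB //; apply/eqP; apply: Nf.
    have -> : sel b - a = (b - a) - (b - sel b) by rewrite opprB [RHS]addrC subrKA.
    exact: submodB.
  exact: submodB.
have [|b bU|v [vW vP]] := bW U (f \o sel).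
- move=> a b c bU cU /=; have [bA bN] := selP _ bU; have [cA cN] := selP _ cU.
  rewrite -fL //; apply: selE; first by rewrite rpredD // AM.
  by rewrite opprD addrACA -mulrBr rpredD // NM.
- by have [sA _] := selP _ bU; have [] := fW _ sA.
exists v; split; first (split=> //; exists j).
  have xU : x ^+ j \in U by apply/UP; exists 0; rewrite rpred0 subr0.
  by rewrite -vP //= (@selE 0) ?rpred0 ?subr0.
move=> b bA; rewrite -vP /=; first by rewrite (@selE b) // subrr rpred0.
by apply/UP; exists b; rewrite subrr rpred0.
Qed.

(* Once the annihilator of [y ^+ l] is stable, the map
   [y ^+ l.+1 * r |-> (y ^+ l * r) *: w] is well defined. *)
Lemma baer_div (V : lmodType R) (W : V -> Prop) : baer W ->
    (forall a w, W w -> W (a *: w)) ->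
  forall y w, W w -> exists v l, W v /\ y ^+ l *: (y *: v - w) = 0.
Proof.
move=> bW WZ y w Ww.
have [l lP] : exists l, forall n s, y ^+ n * s = 0 -> y ^+ l * s = 0.
  have /choice [C CP] : forall n, exists C : submodClosed R^o,
      forall b, b \in C <-> y ^+ n * b = 0.
    move=> n; apply: submod_of => [|a b c bN cN]; first by rewrite mulr0.
    by rewrite mulrDr cN addr0 mulrCA bN mulr0.
  have [|j jP] := noetherian_chain hR (A := C).
    by move=> n b /CP bN; apply/CP; rewrite exprS -mulrA bN mulr0.
  by exists j => n s /CP/jP/CP.
have [||A AP] := @submod_of R R^o (fun b => exists r, b = y ^+ l.+1 * r).
- by exists 0; rewrite mulr0.
- by move=> a _ _ [r ->] [s ->]; exists (a * r + s); rewrite mulrDr mulrCA.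
have /choice [r rP] : forall b, exists r, b \in A -> b = y ^+ l.+1 * r.
  move=> b; have [/AP[r ->]|nbA] := pselect (b \in A); first by exists r.
  by exists 0 => /nbA.
have rE b s : b = y ^+ l.+1 * s -> y ^+ l * r b = y ^+ l * s.
  move=> bs; apply/eqP; rewrite -subr_eq0 -mulrBr; apply/eqP.
  apply: (lP l.+1); rewrite mulrBr -bs -rP ?subrr //.
  by apply/AP; exists s.
have [|b bA|v [Wv vP]] := bW A (fun b => (y ^+ l * r b) *: w).
- move=> a b c bA cA; rewrite scalerA -scalerDl; congr (_ *: w).
  by rewrite mulrCA -mulrDr; apply: rE; rewrite mulrDr mulrCA -!rP.
- exact: WZ.
exists v, l; split=> //; rewrite scalerBr scalerA -exprSr -vP.
  by rewrite (@rE _ 1) ?mulr1 ?subrr.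
by apply/AP; exists 1; rewrite mulr1.
Qed.

(** Baer's criterion passes from the whole module to torsion along the list, one element at a time,
    and then [baer_div] divides inside the torsion. *)
Lemma injective_flasque (V : lmodType R) : injective_module V -> flasque V.
Proof.
move=> iV xs; suff bV : baer (@tors R V xs).
  by move=> x w tw; apply: baer_div tw => // a v; apply: torsZ.
elim: xs => [|x xs /(@baer_tors _ _ x) IHxs].
  suff <- : (fun=> True) = @tors R V [::] by apply: injective_baer.
  by apply/funext => v; apply/propext; split=> // _ x.
congr baer: IHxs; apply/funext => v; apply/propext.
by split=> [[tv xv]|/tors_cons[xv tv]] //; apply/tors_cons.
Qed.

End InjectiveFlasque.

(** * Comparison of resolutions *)

Definition restr (R S : comNzRingType) (f : {rmorphism R -> S}) (V : lmodType S) : Type := V.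

Section Restriction.
Variables (R S : comNzRingType) (f : {rmorphism R -> S}).
Local Notation restr := (restr f).

Section Module.
Variable V : lmodType S.
HB.instance Definition _ := GRing.Zmodule.on (restr V).

Definition restr_scale (a : R) (v : restr V) : restr V := f a *: (v : V).

Fact restr_scaleA a b v : restr_scale a (restr_scale b v) = restr_scale (a * b) v.
Proof. by rewrite /restr_scale scalerA rmorphM. Qed.
Fact restr_scale1 : left_id 1 restr_scale.
Proof. by move=> v; rewrite /restr_scale rmorph1 scale1r. Qed.
Fact restr_scaleDr : right_distributive restr_scale +%R.
Proof. by move=> a u v; apply: scalerDr. Qed.
Fact restr_scaleDl v : {morph restr_scale^~ v : a b / a + b}.
Proof. by move=> a b; rewrite /restr_scale rmorphD scalerDl. Qed.

HB.instance Definition _ := GRing.Zmodule_isLmodule.Build R (restr V)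
  restr_scaleA restr_scale1 restr_scaleDr restr_scaleDl.

Lemma restr_scaleE a (v : restr V) : a *: v = (f a *: (v : V)) :> V.
Proof. by []. Qed.

Lemma tors_restr (xs : seq R) (v : V) :
  tors xs (v : restr V) <-> tors [seq f x | x <- xs] v.
Proof.
split=> tv x; last first.
  by move=> xs_x; have [k] := tv (f x) (map_f f xs_x); exists k; rewrite restr_scaleE rmorphXn.
by move=> /mapP[y /tv[k kv] ->]; exists k; rewrite -rmorphXn.
Qed.

(** The action of [R] goes through [f], so the condition for a list in [R] is the condition over [S]
    for its image. Injectivity is not preserved in this way in general. *)
Lemma flasque_restr : flasque V -> flasque (restr V).
Proof.
move=> fV xs x w /tors_restr tw; have [v [k [tv kv]]] := fV _ (f x) w tw.
by exists v, k; split; [exact/tors_restr | rewrite restr_scaleE rmorphXn].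
Qed.

End Module.

Section Linear.
Variables (U V : lmodType S) (g : {linear U -> V}).
Definition restr_lin (u : restr U) : restr V := g u.
Fact restr_lin_linear : linear restr_lin.
Proof. by move=> a u v; apply: linearP. Qed.
HB.instance Definition _ :=
  GRing.isLinear.Build R (restr U) (restr V) *:%R restr_lin restr_lin_linear.
End Linear.

End Restriction.

Arguments restr_lin {R S} f {U V} g u.
Arguments restr_scaleE {R S} f {V} a v.

Section Comparison.
Variable R : comNzRingType.

(** [g] factors through the image of [p], a submodule of [W], and injectivity of [E] extends it from
    there. *)
Lemma injective_extend (E V W : lmodType R) (p : {linear V -> W}) (g : {linear V -> E}) :
    injective_module E -> (forall v, p v = 0 -> g v = 0) ->
  exists h : {linear W -> E}, forall v, h (p v) = g v.
Proof.
move=> iE pg.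
have [||A AP] := @submod_of R W (fun w => exists v, p v = w).
- by exists 0; rewrite linear0.
- by move=> a _ _ [u <-] [v <-]; exists (a *: u + v); rewrite linearP.
have /choice [s sP] : forall u : submodule A, exists v, p v = val u.
  by move=> u; apply/AP/valP.
have gs u v : p v = val u -> g (s u) = g v.
  move=> pv; apply/eqP; rewrite -subr_eq0 -linearB; apply/eqP/pg.
  by rewrite linearB sP pv subrr.
have [i iE'] := @linear_of R (submodule A) W val (fun a x y => erefl).
have [g' gE'] : exists g' : {linear submodule A -> E}, g' =1 g \o s.
  apply: linear_of => a u v /=; rewrite -linearP; apply: gs.
  by rewrite linearP !sP.
have [|h hP] := iE _ _ i g'; first by move=> u v; rewrite !iE' => /val_inj.
have AV v : p v \in A by apply/AP; exists v.
exists h => v; have := hP (Submodule (AV v)).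
by rewrite iE' gE' /= => ->; apply: gs.
Qed.

(** The comparison theorem for resolutions. Injectivity is asked of the target only, since the
    source will be a resolution over [S] restricted to [R]. *)
Lemma chain_map (N : lmodType R) (J : nat -> lmodType R) (j : {linear N -> J 0})
    (d : forall n, {linear J n -> J n.+1}) (E : injective_resolution N) :
    injective j -> (forall x, d 0 x = 0 -> exists y, j y = x) ->
    (forall n x, d n.+1 x = 0 -> exists y, d n y = x) ->
  exists phi : forall n, {linear J n -> E n},
    (forall y, phi 0 (j y) = res_aug E y) /\
    forall n x, phi n.+1 (d n x) = res_d E n (phi n x).
Proof.
move=> j_inj e0 e.
have [|phi0 phi0P] := @injective_extend (E 0) N (J 0) j (res_aug E) (@res_inj _ _ E 0).
  by move=> y; rewrite -(linear0 j) => /j_inj ->; rewrite linear0.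
(* This invariant is the hypothesis under which [injective_extend] yields the next map, so it is
   carried along the recursion. *)
pose P n (g : {linear J n -> E n}) := forall x, d n x = 0 -> res_d E n (g x) = 0.
have P0 : P 0 phi0.
  by move=> _ /e0[y <-]; rewrite phi0P; apply/res_exact0; exists y.
have F n (g : {g | P n g}) : {h : {h | P n.+1 h} |
    forall x, sval h (d n x) = res_d E n (sval g x)}.
  apply: cid; case: g => g Pg /=.
  have [|h hP] := @injective_extend (E n.+1) (J n) (J n.+1) (d n) (res_d E n \o g)
    (@res_inj _ _ E n.+1); first exact: Pg.
  have Ph : P n.+1 h.
    by move=> _ /e[y <-]; rewrite hP; apply/res_exact; exists (g y).
  by exists (exist _ h Ph).
pose phi n := nat_rect (fun n => {g | P n g}) (exist _ phi0 P0) (fun n g => sval (F n g)) n.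
exists (fun n => sval (phi n)); split=> // n x.
exact: (svalP (F n (phi n))).
Qed.

(* The cone of [J -> E], shifted so as to start with [J 0] in degree 0. *)
Section Cone.
Variables (E J : nat -> lmodType R).
Variables (dE : forall n, {linear E n -> E n.+1}) (dJ : forall n, {linear J n -> J n.+1}).
Variable phi : forall n, {linear J n -> E n}.

Definition cone n : lmodType R := if n is k.+1 then (E k * J k.+1)%type else J 0.

Definition cone_d n : cone n -> cone n.+1 :=
  match n with
  | 0 => fun x => (phi 0 x, - dJ 0 x)
  | k.+1 => fun x => (dE k x.1 + phi k.+1 x.2, - dJ k.+1 x.2)
  end.

Arguments cone_d : clear implicits.

Fact cone_d_linear n : linear (cone_d n).
Proof.
case: n => [|n] a x y /=.
  by rewrite (linearP (dJ 0)) linearP opprD -scalerN.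
congr pair => /=; first by rewrite (linearP (dE n)) (linearP (phi n.+1)) scalerDr addrACA.
by rewrite (linearP (dJ n.+1)) opprD -scalerN.
Qed.
HB.instance Definition _ n :=
  GRing.isLinear.Build R (cone n) (cone n.+1) *:%R (cone_d n) (@cone_d_linear n).

(** This says that [a] annihilates the cohomology of the torsion subcomplex, without forming the
    quotient, so that complexes over different rings can be compared. *)
Definition kills_cohomology (V : nat -> lmodType R) (d : forall n, {linear V n -> V n.+1})
    (xs : seq R) (a : R) (i : nat) : Prop :=
  match i with
  | 0 => forall x : V 0, tors xs x -> d 0 x = 0 -> a *: x = 0
  | j.+1 => forall x : V j.+1, tors xs x -> d j.+1 x = 0 ->
              exists y, tors xs y /\ a *: x = d j y
  end.

Hypotheses (fE : forall n, flasque (E n)) (fJ : forall n, flasque (J n)).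
Hypothesis phi_d : forall n x, phi n.+1 (dJ n x) = dE n (phi n x).
Hypothesis ddE : forall n x, dE n.+1 (dE n x) = 0.
Hypothesis ddJ : forall n x, dJ n.+1 (dJ n x) = 0.
Hypothesis eE : forall n x, dE n.+1 x = 0 -> exists y, dE n y = x.
Hypothesis eJ : forall n x, dJ n.+1 x = 0 -> exists y, dJ n y = x.
Hypothesis phi_ker : forall x, dJ 0 x = 0 -> phi 0 x = 0 -> x = 0.
Hypothesis phi_ex : forall e, dE 0 e = 0 -> exists x, dJ 0 x = 0 /\ phi 0 x = e.

(** [phi] is an isomorphism on cycles in degree 0 and both complexes are exact above, so the cone is
    exact; its terms are flasque, hence [exact_tors] applies. For exactness, the [J] component of a
    cycle is a boundary, and a preimage of it corrects the [E] component into a cycle. *)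
Lemma cone_exact_tors (xs : seq R) n (z : cone n.+1) : tors xs z -> cone_d n.+1 z = 0 ->
  exists y : cone n, tors xs y /\ cone_d n y = z.
Proof.
apply: (@exact_tors R cone cone_d).
- by case=> [|k]; [exact: fJ | exact: flasque_pair].
- case=> [|k] x /=; rewrite !linearN /= ddJ !oppr0 phi_d; first by rewrite subrr.
  by rewrite linearD /= ddE add0r subrr.
- by move=> x [/= h /eqP]; rewrite oppr_eq0 => /eqP /phi_ker ->.
have lift k (e : E k) (j : J k.+1) : cone_d k.+1 (e, j) = 0 ->
    exists j', dJ k j' = j /\ dE k (e + phi k j') = 0.
  move=> /= [eq1 /eqP]; rewrite oppr_eq0 => /eqP /eJ[j' jE].
  by exists j'; split=> //; rewrite linearD /= -phi_d jE.
case=> [|k] [e j] /lift[j' [<- ej']].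
  have [x [dx phix]] := phi_ex ej'; exists (x - j').
  by rewrite /= (linearB (phi 0)) (linearB (dJ 0)) dx phix addrK sub0r opprK.
have [e' e'E] := eE ej'; exists (e', - j').
by rewrite /= !linearN /= opprK e'E addrK.
Qed.

(** The long exact sequence by hand. From [E] to [J]: if a φ(j) = d e, then (-e, a j) is a cycle of
    the cone, and writing it as a boundary exhibits a j as a boundary. From [J] to [E]: (e, 0) is
    the boundary of some (e', j') with j' a cycle, and if a j' = d j'' then a e = d (a e' +
    φ(j'')). *)
Lemma cone_kills xs a i : kills_cohomology dE xs a i <-> kills_cohomology dJ xs a i.
Proof.
have t0 := tors0; case: i => [|i]; split=> H.
- move=> j tj dj; apply: phi_ker; first by rewrite linearZ /= dj scaler0.
  by rewrite linearZ /= H //; [exact: tors_linear | rewrite -phi_d dj linear0].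
- move=> e te de; have [||j [tj [je dj]]] := @cone_exact_tors xs 0 (e, 0).
  + exact: tors_pair.
  + by rewrite /= !linear0 addr0 de ?oppr0.
  by rewrite -je -linearZ /= H ?linear0 //; apply/eqP; rewrite -oppr_eq0 dj.
- move=> j tj dj; have [||e [te ej]] := H (phi i.+1 j).
  + exact: tors_linear.
  + by rewrite -phi_d dj linear0.
  have [||y [ty yE]] := @cone_exact_tors xs i (- e, a *: j).
  + by apply: tors_pair; [exact: torsN | exact: torsZ].
  + have daj : dJ i.+1 (a *: j) = 0 by rewrite linearZ /= dj scaler0.
    by rewrite /= daj oppr0 linearN linearZ /= ej addNr.
  (* The two cases differ only because the cone is [J 0], not a pair, in degree 0. *)
  case: i j e y ty yE {tj dj te ej H} => [|i] j e y ty [_ <-].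
    by exists (- y); split; [exact: torsN | rewrite linearN].
  by have [_ ty2] := tors_pairP ty; exists (- y.2); split; [exact: torsN | rewrite linearN].
- move=> e te de; have [||[e' j'] [/tors_pairP /= [te' tj'] [eE' dj']]] :=
    @cone_exact_tors xs i.+1 (e, 0).
  + exact: tors_pair.
  + by rewrite /= !linear0 addr0 de ?oppr0.
  have [|j'' [tj'' jE]] := H j' tj'.
    by apply/eqP; rewrite -oppr_eq0 dj'.
  exists (a *: e' + phi i j''); split.
    by apply: torsD; [exact: torsZ | exact: tors_linear].
  by rewrite linearD linearZ /= -eE' scalerDr -phi_d -jE linearZ.
Qed.

End Cone.
End Comparison.

(** * Subquotients, and change of the base ring in local cohomology *)

Section SubquotientMap.
Variables (R : comNzRingType) (V : lmodType R) (A B : submodClosed V).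

Definition subquot_pi (u : submodule A) : subquot A B := (\pi_(quot_module (@sub_in R V A B)) u)%qT.

Lemma subquot_piZ a u : subquot_pi (a *: u) = a *: subquot_pi u.
Proof. exact: pi_quot_scale. Qed.

Lemma subquot_piD u v : subquot_pi (u + v) = subquot_pi u + subquot_pi v.
Proof. exact: (raddfD \pi_(quot_module (@sub_in R V A B))%qT). Qed.

Lemma subquot_pi_linear a u v : subquot_pi (a *: u + v) = a *: subquot_pi u + subquot_pi v.
Proof. by rewrite subquot_piD subquot_piZ. Qed.

Lemma subquot_pi_surj q : exists u, subquot_pi u = q.
Proof. by exists (repr q); apply: reprK. Qed.

Lemma subquot_pi_eq0 u : subquot_pi u = 0 <-> val u \in B.
Proof.
have -> : (val u \in B) = (u - 0 \in @sub_in R V A B) by rewrite subr0.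
have -> : (0 : subquot A B) = subquot_pi 0.
  by rewrite -[in RHS](scale0r 0) subquot_piZ scale0r.
have -> : (u - 0 \in @sub_in R V A B) = (subquot_pi u == subquot_pi 0).
  exact: (@Quotient.idealrBE _ (quot_ker (@sub_in R V A B)) u 0).
by split=> [/eqP|/eqP].
Qed.

Lemma subquot_pi_eq u v : subquot_pi u = subquot_pi v <-> val u - val v \in B.
Proof.
have -> : val u - val v = val (u - v) by [].
rewrite -subquot_pi_eq0.
have -> : subquot_pi (u - v) = subquot_pi u - subquot_pi v.
  by rewrite subquot_piD -!scaleN1r subquot_piZ.
by split=> [->|/eqP]; [rewrite subrr | rewrite subr_eq0 => /eqP].
Qed.

Lemma ann_subquot (a : R) : (a \in ann (predT : {pred subquot A B})) <->
  forall x, x \in A -> a *: x \in B.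
Proof.
split=> [/asboolP H x xA | H].
  apply/(subquot_pi_eq0 (a *: Submodule xA)).
  by rewrite subquot_piZ H.
apply/asboolP => q _; have [u <-] := subquot_pi_surj q.
by rewrite -subquot_piZ; apply/subquot_pi_eq0/H/valP.
Qed.

End SubquotientMap.

Lemma lc_ann_kills (R : comNzRingType) (m : {pred R}) (M : lmodType R)
    (I : injective_resolution M) (xs : seq R) (a : R) (i : nat) :
    (forall (V : lmodType R) (v : V), v \in torsion m V <-> tors xs v) ->
  (a \in ann (predT : {pred local_cohomology m I i})) <->
  @kills_cohomology R I (res_d I) xs a i.
Proof.
move=> mxs; rewrite ann_subquot; case: i => [|i]; split=> H x.
- by move=> tx dx; apply/eqP/H; apply/andP; split; [exact/mxs | exact/eqP].
- by move=> /andP[/mxs tx /eqP dx]; apply/eqP/H.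
- move=> tx dx; have /H/asboolP[y [/mxs ty yE]] : x \in @lc_cycles R m M I i.+1.
    by apply/andP; split; [exact/mxs | exact/eqP].
  by exists y.
- move=> /andP[/mxs tx /eqP dx]; apply/asboolP.
  by have [y [/mxs ty yE]] := H x tx dx; exists y.
Qed.

Section BaseChange.
Variables (R S : comNzRingType) (f : {rmorphism R -> S}).
Hypotheses (hR : noetherian_ring R) (hS : noetherian_ring S).
Variables (m : {pred R}) (n : {pred S}) (xs : seq R).
Hypothesis m_tors : forall (V : lmodType R) (v : V), v \in torsion m V <-> tors xs v.
Hypothesis n_tors : forall (V : lmodType S) (v : V),
  v \in torsion n V <-> tors [seq f x | x <- xs] v.

(* Independence of the base: an [S]-injective resolution restricts to a
   resolution by flasque [R]-modules. *)
Lemma lc_base_change (N' : lmodType R) (N : lmodType S) (phi : N' -> N)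
    (E : injective_resolution N') (J : injective_resolution N) a i :
    (forall a x y, phi (a *: x + y) = f a *: phi x + phi y) ->
    injective phi -> (forall y, exists x, phi x = y) ->
  (a \in ann (predT : {pred local_cohomology m E i})) <->
  (f a \in ann (predT : {pred local_cohomology n J i})).
Proof.
move=> phiL phi_inj phi_surj.
rewrite (lc_ann_kills _ _ _ m_tors) (lc_ann_kills _ _ _ n_tors).
pose rJ k : lmodType R := restr f (J k).
pose rd k : {linear rJ k -> rJ k.+1} := restr_lin f (res_d J k).
have [j jE] := @linear_of R N' (rJ 0) (fun x => res_aug J (phi x))
  (fun a x y => etrans (congr1 _ (phiL a x y)) (linearP (res_aug J) (f a) _ _)).
have [x y|x|k x|psi [psi0 psi_d]] := @chain_map R N' rJ j rd E.
- by rewrite !jE => /res_aug_inj/phi_inj.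
- move=> /res_exact0[y <-]; have [z <-] := phi_surj y.
  by exists z; rewrite jE.
- by move=> /res_exact.
have ddE : forall k x, res_d E k.+1 (res_d E k x) = 0.
  by move=> k x; apply/res_exact; exists x.
rewrite (@cone_kills R E rJ (res_d E) rd psi) //.
- case: i => [|i]; split=> H x tx dx.
  + by rewrite -(restr_scaleE f); apply: H => //; apply/tors_restr.
  + by rewrite restr_scaleE; apply: H => //; apply/tors_restr.
  + by have [|//|y [/tors_restr ty yE]] := H x; [exact/tors_restr | exists y].
  + by have [|//|y [ty yE]] := H x; [exact/tors_restr | exists y; split=> //; apply/tors_restr].
- by move=> k; apply/(injective_flasque hR)/res_inj.
- by move=> k; apply/flasque_restr/(injective_flasque hS)/res_inj.
- by move=> k x; apply/(@res_exact _ _ J); exists x.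
- by move=> k x /res_exact.
- by move=> k x /(@res_exact _ _ J).
- move=> x /(@res_exact0 _ _ J)[y <-]; have [z <-] := phi_surj y.
  rewrite -jE psi0 => zE.
  suff -> : z = 0 by rewrite linear0.
  by apply: (@res_aug_inj _ _ E); rewrite zE linear0.
- move=> e /res_exact0[y <-]; exists (j y); rewrite psi0 jE; split=> //.
  by apply/(@res_exact0 _ _ J); exists (phi y).
Qed.

End BaseChange.

(** * Injective resolutions *)




Definition rat_int : {pred rat} := fun q => q \is a Num.int.

Fact rat_int_closed : zmod_closed rat_int.
Proof.
split=> [|x y xZ yZ]; first by change ((0 : rat) \is a Num.int); apply: rpred0.
by change (x - y \is a Num.int); apply: rpredB.
Qed.
HB.instance Definition _ := GRing.isZmodClosed.Build rat rat_int rat_int_closed.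

(** Q/Z, an injective cogenerator of abelian groups: it is divisible and has elements of every
    finite order. *)
Definition QZ : zmodType := Quotient.quot rat_int.

Definition QZ_pi (q : rat) : QZ := (\pi_(Quotient.quot rat_int) q)%qT.

Lemma QZ_piMn q n : QZ_pi (q *+ n) = QZ_pi q *+ n.
Proof. exact: raddfMn. Qed.

Lemma QZ_pi_eq0 q : QZ_pi q = 0 <-> q \is a Num.int.
Proof.
have -> : (q \is a Num.int) = (q - 0 \in rat_int) by rewrite subr0.
have -> : (q - 0 \in rat_int) = (QZ_pi q == QZ_pi 0).
  exact: (Quotient.idealrBE rat_int q 0).
have -> : QZ_pi 0 = 0 by apply/(QZ_piMn 0 0).
by split=> /eqP.
Qed.

Lemma QZ_divisible (d : QZ) n : (0 < n)%N -> exists e : QZ, e *+ n = d.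
Proof.
move=> n0; rewrite -[d]reprK; exists (QZ_pi (repr d / n%:R)).
by rewrite -QZ_piMn -[X in QZ_pi X]mulr_natr divfK // pnatr_eq0 -lt0n.
Qed.

(** Subgroups of the integers are cyclic, by division with remainder by the least positive
    member. *)
Lemma int_subgroup_min (P : int -> Prop) : P 0 -> (forall x y, P x -> P y -> P (x - y)) ->
  (forall z, P z -> z = 0) \/
  exists k : nat, [/\ (0 < k)%N, P k%:Z & forall z, P z -> (k%:Z %| z)%Z].
Proof.
move=> P0 PB; have [[k0 [k0_gt0 Pk0]]|noP] := pselect (exists k : nat, (0 < k)%N /\ P k%:Z).
  right; have ex : exists k, (0 < k)%N && `[< P k%:Z >].
    by exists k0; rewrite k0_gt0; apply/asboolP.
  have [k /andP[k_gt0 /asboolP Pk] kmin] := ex_minnP ex; exists k; split=> // z Pz.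
  have PN x : P x -> P (- x) by move=> Px; rewrite -sub0r; apply: PB.
  have PMn (x : int) n : P x -> P (x *+ n).
    move=> Px; elim: n => [|n IHn] //; rewrite mulrS -[X in X + _]opprK addrC.
    by apply: PB => //; apply: PN.
  have PM (x y : int) : P x -> P (x * y).
    move=> Px; case: y => n; first by rewrite -[Posz n]natz mulr_natr; apply: PMn.
    by rewrite NegzE mulrN -natz mulr_natr; apply/PN/PMn.
  have Pr : P (z %% k%:Z)%Z by rewrite /modz; apply: PB => //; rewrite mulrC; apply: PM.
  have kn0 : k%:Z != 0 by rewrite -lt0n.
  apply/dvdz_mod0P; move: Pr (modz_ge0 z kn0) (ltz_mod z kn0); case: (_ %% _)%Z => [[|r]|r] // Pr _.
  rewrite gtr0_norm // ltz_nat => rk.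
  by have := kmin r.+1 (introT (asboolP _) Pr); rewrite leqNgt rk.
left=> z Pz; apply: contrapT => z0; apply: noP; exists `|z|%N; split.
  by rewrite absz_gt0; apply/eqP.
rewrite abszE; case: (ger0P z) => // _.
by rewrite -sub0r; apply: PB.
Qed.

(* Zorn's lemma on graphs of partial homomorphisms. *)
Lemma QZ_extend (V : zmodType) (Gr : V -> QZ -> Prop) :
    Gr 0 0 -> (forall a b c d, Gr a c -> Gr b d -> Gr (a - b) (c - d)) ->
    (forall c, Gr 0 c -> c = 0) ->
  exists h : V -> QZ, (forall a b, h (a + b) = h a + h b) /\
    forall a c, Gr a c -> h a = c.
Proof.
move=> G0 GB Gf.
pose sub (X : set (V * QZ)) := forall p q, X p -> X q -> X (p - q).
pose P (X : set (V * QZ)) := X = set0 \/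
  [/\ (forall a c, Gr a c -> X (a, c)), sub X & forall c, X (0, c) -> c = 0].
pose GrS : set (V * QZ) := fun p => Gr p.1 p.2.
have PGr : P GrS.
  by right; split=> // [[a c] [b d]] /=; apply: GB.
have [F FP Ftot|G [[G_eq0|[GrG Gsub Gfun]] Gmax]] := @Zorn_bigcup (V * QZ) P.
- have [all0|/existsNP[X0 /not_implyP[FX0 X0n]]] := pselect (forall X, F X -> X = set0).
    left; rewrite -subset0 => p [X /all0 ->].
    by [].
  have good X : F X -> X <> set0 ->
      [/\ (forall a c, Gr a c -> X (a, c)), sub X & forall c, X (0, c) -> c = 0].
    by move=> /FP[].
  have nz X p : X p -> X <> set0 :> set (V * QZ) by move=> Xp XE; rewrite XE in Xp.
  right; split.
  + by move=> a c ac; exists X0 => //; have [h _ _] := good _ FX0 X0n; apply: h.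
  + move=> p q [X FX Xp] [Y FY Yq]; have [XY|YX] := Ftot _ _ FX FY.
      by exists Y => //; have [_ h _] := good _ FY (nz _ _ Yq); apply: h => //; apply: XY.
    by exists X => //; have [_ h _] := good _ FX (nz _ _ Xp); apply: h => //; apply: YX.
  + by move=> c [X FX Xc]; have [_ _ h] := good _ FX (nz _ _ Xc); apply: h.
- exfalso; apply: (Gmax GrS) => //; rewrite G_eq0; split=> //.
  by move=> /(_ (0, 0)); apply.
have GN p : G p -> G (- p) by move=> Gp; rewrite -sub0r; apply: Gsub => //; apply: GrG.
have GD p q : G p -> G q -> G (p + q).
  by move=> Gp Gq; rewrite -[q]opprK; apply: Gsub => //; apply: GN.
have GMn p n : G p -> G (p *+ n).
  by move=> Gp; elim: n => [|n IHn]; [exact: GrG | rewrite mulrS; apply: GD].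
have GMz p z : G p -> G (p *~ z).
  by move=> Gp; case: z => n; [exact: GMn | rewrite NegzE mulrNz; apply/GN/GMn].
have Gfun2 a c d : G (a, c) -> G (a, d) -> c = d.
  move=> Gc Gd; apply/eqP; rewrite -subr_eq0; apply/eqP/Gfun.
  have -> : ((0, c - d) : V * QZ) = (a, c) - (a, d) by congr pair; rewrite /= subrr.
  exact: Gsub.
have pairMz (b : V) (d : QZ) z : (b, d) *~ z = (b *~ z, d *~ z).
  have pairMn n : (b, d) *+ n = (b *+ n, d *+ n).
    by elim: n => // n IHn; rewrite !mulrS IHn.
  by case: z => n; rewrite ?NegzE ?mulrNz -!pmulrn pairMn.
suff Gtot b : exists e, G (b, e).
  have [h hP] := choice Gtot; exists h; split=> [a b|a c /GrG Gac].
    by apply: (Gfun2 (a + b)) => //; apply: (GD (_, _) (_, _)).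
  exact: Gfun2 (hP a) Gac.
apply: contrapT => nb.
(* The value to be given to [b]. The integers z with z b in the domain of [G] form a subgroup; if k
   > 0 generates it, [d] is a k-th part of the value at k b, which exists by divisibility. If the
   subgroup is zero any value will do, and 0 is taken. *)
have [d dP] : exists d : QZ, forall z e, G (b *~ z, e) -> e = d *~ z.
  have [||Z0|[k [k_gt0 [e Ge] kdvd]]] := @int_subgroup_min (fun z => exists e, G (b *~ z, e)).
  - by exists 0; apply: GrG.
  - move=> x y [e Ge] [e' Ge']; exists (e - e'); rewrite mulrzBr.
    exact: (Gsub (_, _) (_, _)).
  - exists 0 => z e Gz; have z0 : z = 0 by apply: Z0; exists e.
    by rewrite z0 in Gz *; apply: Gfun.
  have [d dE] := QZ_divisible e k_gt0; exists d => z e' Gz.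
  have /dvdzP[q zE] : (k%:Z %| z)%Z by apply: kdvd; exists e'.
  have -> : d *~ z = e *~ q by rewrite zE mulrC mulrzA -dE pmulrn.
  apply: (Gfun2 (b *~ z)) => //; rewrite zE mulrC mulrzA -pairMz.
  exact: GMz.
pose G' : set (V * QZ) := fun p => exists q z, G q /\ p = q + (b, d) *~ z.
apply: (Gmax G'); last first.
  right; split.
  - by move=> a c /GrG Gac; exists (a, c), 0; rewrite mulr0z addr0.
  - move=> _ _ [p [x [Gp ->]]] [q [y [Gq ->]]]; exists (p - q), (x - y).
    by rewrite mulrzBr opprD addrACA; split=> //; apply: Gsub.
  - move=> c [[a c'] [z [Gac]]]; rewrite pairMz => -[/esym/eqP].
    rewrite addr_eq0 => /eqP aE ->.
    suff -> : c' = - (d *~ z) by rewrite addNr.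
    apply/eqP; rewrite -eqr_oppLR; apply/eqP/dP.
    by have := GN _ Gac; rewrite aE /= -[- (_, _)]/(- - _, - c') opprK.
split; first by move=> p Gp; exists p, 0; rewrite mulr0z addr0.
move=> /(_ (b, d)) Gbd; apply: nb; exists d; apply: Gbd.
by exists 0, 1; rewrite mulr1z add0r; split=> //; apply: GrG.
Qed.

(** On the subgroup generated by [x], send [x] to 1/k, where k > 1 divides every integer that kills
    [x]: the order of [x], or the arbitrary value 2 if the order is infinite. As k > 1, the image is
    not zero. *)
Lemma QZ_cogenerator (V : zmodType) (x : V) : x != 0 ->
  exists h : V -> QZ, (forall a b, h (a + b) = h a + h b) /\ h x != 0.
Proof.
move=> x0.
have [k [k_gt1 kP]] : exists k : nat, (1 < k)%N /\
    forall z : int, x *~ z = 0 -> (k%:Z %| z)%Z.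
  have [||Z0|[k [k_gt0 kx kdvd]]] := @int_subgroup_min (fun z => x *~ z = 0) => //.
  - by move=> a b xa xb; rewrite mulrzBr xa xb subrr.
  - by exists 2%N; split=> // z /Z0 ->; apply: dvdz0.
  exists k; split=> //; case: k k_gt0 kx kdvd => [|[|k]] // _.
  by rewrite mulr1z => xE; rewrite xE eqxx in x0.
have k0 : k%:R != 0 :> rat by rewrite pnatr_eq0 -lt0n ltnW.
have [|||h [hD hP]] := @QZ_extend V
    (fun a c => exists z : int, a = x *~ z /\ c = QZ_pi k%:R^-1 *~ z).
- by exists 0; rewrite !mulr0z.
- move=> _ _ _ _ [z [-> ->]] [z' [-> ->]]; exists (z - z').
  by rewrite !mulrzBr.
- move=> c [z [/esym/kP/dvdzP[q ->] ->]].
  rewrite mulrC mulrzA -pmulrn -QZ_piMn -[X in QZ_pi X]mulr_natr mulVf //.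
  have -> : QZ_pi 1 = 0 by apply/QZ_pi_eq0/rpred1.
  exact: mul0rz.
exists h; split=> //; rewrite (hP x (QZ_pi k%:R^-1)); last by exists 1.
apply/eqP => /QZ_pi_eq0 /intrP[z zE].
have : 0 < `|z| :> int.
  by rewrite normr_gt0 -(intr_eq0 rat) -zE invr_eq0.
have : (`|z|%:~R : rat) < 1.
  by rewrite intr_norm -zE ger0_norm ?invr_ge0 ?ler0n // invf_lt1 ?ltr1n // ltr0n ltnW.
by rewrite -[1 in X in X -> _]/(1%:~R) ltr_int; case: (`|z|) => [[]|].
Qed.

(* [coind R X] is Hom_Z(R, (Q/Z)^X). *)
Section Coinduced.
Variables (R : comNzRingType) (X : Type).

Definition biadditive : {pred X -> R -> QZ} :=
  [pred h | `[< forall x r s, h x (r + s) = h x r + h x s >]].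

Fact biadditive_closed : zmod_closed biadditive.
Proof.
split=> [|g h /asboolP gD /asboolP hD]; apply/asboolP => x r s.
  by rewrite /= addr0.
by rewrite /= !fctE gD hD opprD addrACA.
Qed.
HB.instance Definition _ :=
  GRing.isZmodClosed.Build (X -> R -> QZ) biadditive biadditive_closed.

Inductive coind : Type := Coind h of h \in biadditive.

Definition coind_val (w : coind) : X -> R -> QZ := let: Coind h _ := w in h.

HB.instance Definition _ := [isSub for coind_val].
HB.instance Definition _ := [Choice of coind by <:].
HB.instance Definition _ := [SubChoice_isSubZmodule of coind by <:].

Lemma coindD (w : coind) x r s : coind_val w x (r + s) = coind_val w x r + coind_val w x s.
Proof. by case: w => h hP; apply: (elimT (asboolP _) hP). Qed.

Lemma coind_ext (w w' : coind) :
  (forall x r, coind_val w x r = coind_val w' x r) -> w = w'.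
Proof. by move=> ww'; apply/val_inj/funext => x; apply/funext => r; apply: ww'. Qed.

Fact coind_scale_subproof (a : R) (w : coind) :
  (fun x r => coind_val w x (r * a)) \in biadditive.
Proof. by apply/asboolP => x r s; rewrite mulrDl coindD. Qed.

Definition coind_scale a w : coind := Coind (coind_scale_subproof a w).

Fact coind_scaleA a b w : coind_scale a (coind_scale b w) = coind_scale (a * b) w.
Proof. by apply: coind_ext => x r; rewrite /= mulrA. Qed.
Fact coind_scale1 : left_id 1 coind_scale.
Proof. by move=> w; apply: coind_ext => x r; rewrite /= mulr1. Qed.
Fact coind_scaleDr : right_distributive coind_scale +%R.
Proof. by move=> a u v; apply: coind_ext. Qed.
Fact coind_scaleDl w : {morph coind_scale^~ w : a b / a + b}.
Proof. by move=> a b; apply: coind_ext => x r; rewrite /= mulrDr coindD. Qed.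

HB.instance Definition _ := GRing.Zmodule_isLmodule.Build R coind
  coind_scaleA coind_scale1 coind_scaleDr coind_scaleDl.

(** Evaluation at 1 identifies [R]-linear maps into Hom_Z(R, D) with additive maps into D. So each
    coordinate is extended additively by [QZ_extend], and r ↦ h(r v) recovers linearity. *)
Lemma coind_injective : injective_module coind.
Proof.
move=> U V f g f_inj.
have /choice [h hP] : forall x, exists h : V -> QZ, (forall a b, h (a + b) = h a + h b) /\
    forall a c, (exists u, f u = a /\ c = coind_val (g u) x 1) -> h a = c.
  move=> x; apply: QZ_extend.
  - by exists 0; rewrite !linear0.
  - move=> _ _ _ _ [u [<- ->]] [v [<- ->]]; exists (u - v).
    by rewrite !linearB.
  - by move=> c [u []]; rewrite -(linear0 f) => /f_inj -> ->; rewrite linear0.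
have hadd v : (fun x r => h x (r *: v)) \in biadditive.
  by apply/asboolP => x r s; rewrite scalerDl (hP x).1.
have [|k kE] := @linear_of R V coind (fun v => Coind (hadd v)).
  move=> a u v; apply: coind_ext => x r /=.
  by rewrite scalerDr (hP x).1 scalerA.
exists k => u; rewrite kE; apply: coind_ext => x r /=.
by apply: (hP x).2; exists (r *: u); rewrite !linearZ /= mul1r.
Qed.

End Coinduced.

Section Resolution.
Variable R : comNzRingType.

(** The index set is [M] itself: the coordinate [x] carries a character that does not vanish at [x],
    so every nonzero element is detected by its own coordinate. *)
Lemma enough_injectives (M : lmodType R) :
  exists E : lmodType R, injective_module E /\ exists i : {linear M -> E}, injective i.
Proof.
have /choice [chi chiP] : forall x : M, exists h : M -> QZ,
    (forall a b, h (a + b) = h a + h b) /\ (x != 0 -> h x != 0).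
  move=> x; have [-> | /QZ_cogenerator[h [hD hx]]] := eqVneq x 0.
    by exists (fun=> 0); split=> [a b|//]; rewrite addr0.
  by exists h.
have cadd y : (fun x r => chi x (r *: y)) \in @biadditive R M.
  by apply/asboolP => x r s; rewrite scalerDl (chiP x).1.
exists (coind R M); split; first exact: coind_injective.
have [|i iE] := @linear_of R M (coind R M) (fun y => Coind (cadd y)).
  move=> a y z; apply: coind_ext => x r /=.
  by rewrite scalerDr (chiP x).1 scalerA.
exists i => y z yz; apply: contrapT => /eqP; rewrite -subr_eq0 => yz0.
have /eqP := (chiP (y - z)).2 yz0; apply.
have : i (y - z) = 0 by rewrite linearB yz subrr.
rewrite iE => /(congr1 (fun w => coind_val w (y - z) 1)) /=.
by rewrite scale1r.
Qed.

Lemma cokernel (M E : lmodType R) (i : {linear M -> E}) :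
  exists (C : lmodType R) (p : {linear E -> C}),
    (forall c, exists e, p e = c) /\ forall e, p e = 0 <-> exists x, i x = e.
Proof.
have [||B BP] := @submod_of R E (fun e => exists x, i x = e).
- by exists 0; rewrite linear0.
- by move=> a _ _ [x <-] [y <-]; exists (a *: x + y); rewrite linearP.
have [||A AP] := @submod_of R E (fun=> True) => //.
have AT e : e \in A by apply/AP.
exists (subquot A B).
have [|p pE] := @linear_of R E (subquot A B) (fun e => subquot_pi B (Submodule (AT e))).
  move=> a x y; rewrite -subquot_pi_linear; congr subquot_pi.
  exact: val_inj.
exists p; split=> [c|e].
  have [u <-] := subquot_pi_surj c; exists (val u).
  by rewrite pE; congr subquot_pi; apply: val_inj.
by rewrite pE -BP; apply: subquot_pi_eq0.
Qed.

(** Embeddings into injectives are spliced along their cokernels. Because [lc_ann] quantifies over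
    all resolutions, its value on a module can be tested only once a resolution is at hand. *)
Lemma resolution_exists (M : lmodType R) : exists I : injective_resolution M, True.
Proof.
pose emb (M : lmodType R) := cid (enough_injectives M).
pose E (M : lmodType R) := sval (emb M).
pose iota (M : lmodType R) : {linear M -> E M} := sval (cid (svalP (emb M)).2).
have iota_inj (M' : lmodType R) : injective (iota M') := svalP (cid (svalP (emb M')).2).
have E_inj (M' : lmodType R) : injective_module (E M') := (svalP (emb M')).1.
pose cok (M : lmodType R) := cid (cokernel (iota M)).
pose C (M : lmodType R) := sval (cok M).
pose p (M : lmodType R) : {linear E M -> C M} := sval (cid (svalP (cok M))).
have pP (M' : lmodType R) := svalP (cid (svalP (cok M'))); rewrite -/(p _) in pP.
(* The cosyzygies of [M]; the differential is the cokernel map followed by the next embedding. *)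
pose Z n := iter n C M.
pose d n : {linear E (Z n) -> E (Z n.+1)} := iota (Z n.+1) \o p (Z n).
have dE n x : d n x = 0 <-> p (Z n) x = 0.
  rewrite /d /=; split=> [|->]; last exact: linear0.
  by rewrite -(linear0 (iota _)) => /iota_inj.
unshelve eexists; last by [].
apply: (@Build_injective_resolution R M (fun n => E (Z n)) (iota M) d).
- by move=> n; apply: E_inj.
- exact: iota_inj.
- by move=> x; rewrite dE; apply: (pP M).2.
move=> n x; rewrite dE; split=> [/((pP _).2)[z <-]|[y <-]].
  by have [y <-] := (pP (Z n)).1 z; exists y.
by apply/(pP (Z n.+1)).2; exists (p _ y).
Qed.

End Resolution.

(** * Annihilators of local cohomology *)

Section Torsion.
Variable R : comNzRingType.

Fixpoint span (xs : seq R) (a : R) : Prop :=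
  if xs is x :: xs' then exists b c, a = b * x + c /\ span xs' c else a = 0.

Lemma span_sum (I : Type) (r : seq I) (c g : I -> R) :
  span [seq g i | i <- r] (\sum_(i <- r) c i * g i).
Proof.
elim: r => [|i r IHr]; first by rewrite big_nil.
by rewrite big_cons; exists (c i), (\sum_(j <- r) c j * g j).
Qed.

(** The N-th power of the ideal generated by [P] kills [v], unfolded one factor at a time to avoid
    sums of products. *)
Fixpoint kills_power (P : R -> Prop) (V : lmodType R) (N : nat) (v : V) : Prop :=
  if N is N'.+1 then forall b, P b -> kills_power P N' (b *: v) else v = 0.

Section KillsPower.
Variables (P : R -> Prop) (V : lmodType R).

Lemma kills_power0 N : kills_power P N (0 : V).
Proof. by elim: N => [|N IHN] //= b _; rewrite scaler0. Qed.

Lemma kills_powerD N (v w : V) : kills_power P N v -> kills_power P N w ->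
  kills_power P N (v + w).
Proof.
elim: N v w => [|N IHN] v w /=; first by move=> -> ->; rewrite addr0.
by move=> Nv Nw b Pb; rewrite scalerDr; apply: IHN; [apply: Nv | apply: Nw].
Qed.

Lemma kills_powerZ N a (v : V) : kills_power P N v -> kills_power P N (a *: v).
Proof.
elim: N v => [|N IHN] v /=; first by move=> ->; rewrite scaler0.
by move=> Nv b Pb; rewrite scalerA mulrC -scalerA; apply/IHN/Nv.
Qed.

Lemma kills_powerS k N (v : V) : kills_power P N v -> kills_power P (k + N) v.
Proof.
elim: k => [|k IHk] // Nv; rewrite addSn => b Pb.
by apply: kills_powerZ; apply: IHk.
Qed.

End KillsPower.

Lemma kills_idealX (m : {pred R}) (V : lmodType R) N (v : V) :
  (forall a, a \in idealX m N -> a *: v = 0) <-> kills_power (fun a => a \in m) N v.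
Proof.
elim: N v => [|N IHN] v /=.
  by split=> [/(_ 1 isT)|-> a _]; [rewrite scale1r | rewrite scaler0].
split=> [Nv b mb | Nv _ /asboolP[s [sP ->]]].
  apply/IHN => a aN; rewrite scalerA mulrC; apply: Nv.
  apply/asboolP; exists [:: (b, a)]; split; first by move=> p; rewrite inE => /eqP ->.
  by rewrite big_seq1.
rewrite scaler_suml big_seq big1 // => p /sP[p1 p2].
by rewrite mulrC -scalerA; apply: ((IHN _).2 (Nv _ p1)).
Qed.

Lemma kills_power_tors (xs : seq R) (V : lmodType R) (v : V) : tors xs v ->
  exists N, kills_power (span xs) N v.
Proof.
elim: xs v => [|x xs IHxs] v.
  by move=> _; exists 1%N => b ->; rewrite scale0r.
(* Multiply [u] by [b * x + c]: the first term leads to [x *: u], for which N1 factors suffice, and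
   the second uses up one of the N2 factors. *)
have shift N1 N2 (u : V) : kills_power (span xs) N2 u ->
    kills_power (span (x :: xs)) N1 (x *: u) -> kills_power (span (x :: xs)) (N2 + N1) u.
  elim: N2 u => [|N2 IHN] u; first by move=> -> _; apply: kills_power0.
  move=> Nu Nxu _ [b [c [-> xsc]]]; rewrite scalerDl; apply: kills_powerD.
    by rewrite -scalerA; apply/kills_powerZ/kills_powerS.
  apply: IHN; first exact: Nu.
  by rewrite scalerA mulrC -scalerA; apply: kills_powerZ.
move=> /tors_cons[[n]]; elim: n v => [|n IHn] v.
  by rewrite expr0 scale1r => -> _; exists 0%N.
rewrite exprSr -scalerA => xv tv.
have [N1 N1P] := IHn _ xv (torsZ x tv); have [N2 N2P] := IHxs v tv.
by exists (N2 + N1)%N; apply: shift.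
Qed.

Lemma kills_power_exp (P : R -> Prop) (V : lmodType R) N (v : V) a :
  P a -> kills_power P N v -> a ^+ N *: v = 0.
Proof.
move=> Pa; elim: N v => [|N IHN] v /=; first by rewrite expr0 scale1r.
by move=> /(_ a Pa)/IHN; rewrite exprSr scalerA.
Qed.

Lemma torsion_exp (m : {pred R}) (V : lmodType R) (v : V) a :
  a \in m -> v \in torsion m V -> exists k, a ^+ k *: v = 0.
Proof. by move=> ma /asboolP[N /kills_idealX /(kills_power_exp ma)]; exists N. Qed.

Lemma kills_power_sub (P Q : R -> Prop) (V : lmodType R) N (v : V) :
  (forall a, Q a -> P a) -> kills_power P N v -> kills_power Q N v.
Proof.
by move=> QP; elim: N v => [|N IHN] v //= Nv b /QP Pb; apply/IHN/Nv.
Qed.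

Lemma torsion_span (m : {pred R}) (xs : seq R) :
    {subset xs <= m} -> (forall a, a \in m -> span xs a) ->
  forall (V : lmodType R) (v : V), v \in torsion m V <-> tors xs v.
Proof.
move=> xsm mxs V v; split=> [tv x /xsm mx | /kills_power_tors[N Nv]].
  exact: torsion_exp tv.
by apply/asboolP; exists N; apply/kills_idealX; apply: kills_power_sub Nv.
Qed.

Lemma torsion_tors (hR : noetherian_ring R) (m : idealr R) :
  exists xs : seq R, {subset xs <= m} /\
    forall (V : lmodType R) (v : V), v \in torsion m V <-> tors xs v.
Proof.
have [A AE] := idealr_submod m; have [n [g [gA Ag]]] := hR A.
have sm : {subset [seq (g i : R) | i <- enum 'I_n] <= m}.
  by move=> _ /mapP[i _ ->]; rewrite -AE.
exists [seq g i | i <- enum 'I_n]; split=> //.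
apply: torsion_span => // a; rewrite -AE => /Ag[c ->].
by have := @span_sum _ (enum 'I_n) c g; rewrite big_enum.
Qed.

End Torsion.

Section LcAnn.

Lemma lc_annM (R : comNzRingType) (m : {pred R}) (M : lmodType R) i a b :
  b \in lc_ann m M i -> a * b \in lc_ann m M i.
Proof.
move=> /asboolP H; apply/asboolP => I; apply/asboolP => x _.
by rewrite -scalerA; have /asboolP -> := H I; rewrite ?scaler0.
Qed.

(** Independence of the resolution is base change along the identity of [R]. *)
Lemma lc_annP (R : comNzRingType) (hR : noetherian_ring R) (m : idealr R)
    (M : lmodType R) (I : injective_resolution M) a i :
  a \in lc_ann m M i <-> a \in ann (predT : {pred local_cohomology m I i}).
Proof.
split=> [/asboolP//|H]; apply/asboolP => J.
have [xs [_ xsP]] := torsion_tors hR m.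
have := @lc_base_change R R idfun hR hR m m xs xsP.
by rewrite map_id => /(_ xsP M M id J I a i) -> // y; exists y.
Qed.

Lemma lc_ann_base_change (R S : comNzRingType) (f : {rmorphism R -> S})
    (hR : noetherian_ring R) (hS : noetherian_ring S) (m : idealr R) (n : idealr S)
    (xs : seq R) (N' : lmodType R) (N : lmodType S) (phi : N' -> N) :
    (forall (V : lmodType R) (v : V), v \in torsion m V <-> tors xs v) ->
    (forall (V : lmodType S) (v : V), v \in torsion n V <-> tors [seq f x | x <- xs] v) ->
    (forall a x y, phi (a *: x + y) = f a *: phi x + phi y) ->
    injective phi -> (forall y, exists x, phi x = y) ->
  forall a i, a \in lc_ann m N' i <-> f a \in lc_ann n N i.
Proof.
move=> mP nP phiL phi_inj phi_surj a i.
have [E _] := resolution_exists N'; have [J _] := resolution_exists N.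
rewrite (lc_annP hR m E) (lc_annP hS n J).
exact: (lc_base_change hR hS mP nP).
Qed.

Lemma lc_ann_iso (R : comNzRingType) (hR : noetherian_ring R) (m : idealr R)
    (N' N : lmodType R) (phi : N' -> N) :
    (forall a x y, phi (a *: x + y) = a *: phi x + phi y) ->
    injective phi -> (forall y, exists x, phi x = y) ->
  forall a i, a \in lc_ann m N' i <-> a \in lc_ann m N i.
Proof.
have [xs [_ xsP]] := torsion_tors hR m.
by apply: (@lc_ann_base_change R R idfun hR hR m m xs N' N phi); rewrite ?map_id.
Qed.

Section Pair.
Variable R : comNzRingType.

Lemma injective_pair (E F : lmodType R) : injective_module E -> injective_module F ->
  injective_module (E * F)%type.
Proof.
move=> iE iF U V f g f_inj.
have [h hP] := iE U V f (fst \o g) f_inj; have [k kP] := iF U V f (snd \o g) f_inj.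
have [|l lP] := @linear_of R V (E * F)%type (fun v => (h v, k v)).
  by move=> a x y; rewrite !linearP.
by exists l => u; rewrite lP hP kP /=; case: (g u).
Qed.

Variables (A B : lmodType R) (I : injective_resolution A) (J : injective_resolution B).

Definition pair_res n : lmodType R := (I n * J n)%type.
Definition pair_d n (x : pair_res n) : pair_res n.+1 := (res_d I n x.1, res_d J n x.2).
Fact pair_d_linear n : linear (@pair_d n).
Proof. by move=> a x y; rewrite /pair_d /= !linearP. Qed.
HB.instance Definition _ n := GRing.isLinear.Build R (pair_res n) (pair_res n.+1) *:%R
  (@pair_d n) (@pair_d_linear n).
Definition pair_aug (x : (A * B)%type) : pair_res 0 := (res_aug I x.1, res_aug J x.2).
Fact pair_aug_linear : linear pair_aug.
Proof. by move=> a x y; rewrite /pair_aug /= !linearP. Qed.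
HB.instance Definition _ := GRing.isLinear.Build R (A * B)%type (pair_res 0) *:%R
  pair_aug pair_aug_linear.

Definition pair_resolution : injective_resolution (A * B)%type.
Proof.
apply: (@Build_injective_resolution R (A * B)%type pair_res pair_aug
  (fun n => @pair_d n : {linear _ -> _})).
- by move=> n; apply: injective_pair; apply: res_inj.
- by move=> [a b] [a' b'] [/res_aug_inj -> /res_aug_inj ->].
- move=> [x y]; split=> [[/res_exact0[a <-] /res_exact0[b <-]]|[[a b] [<- <-]]].
    by exists (a, b).
  by congr pair; [apply/(@res_exact0 _ _ I); exists a | apply/(@res_exact0 _ _ J); exists b].
move=> n [x y]; split=> [[/res_exact[a <-] /res_exact[b <-]]|[[a b] [<- <-]]].
  by exists (a, b).
by congr pair; [apply/(@res_exact _ _ I); exists a | apply/(@res_exact _ _ J); exists b].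
Defined.

Lemma kills_pair xs a i :
  @kills_cohomology R pair_resolution (res_d pair_resolution) xs a i <->
  @kills_cohomology R I (res_d I) xs a i /\ @kills_cohomology R J (res_d J) xs a i.
Proof.
have t0 := tors0; case: i => [|i]; split=> [H|[HI HJ]].
- split=> x tx dx.
    have dx0 : res_d pair_resolution 0 (x, 0) = 0 by congr pair; rewrite //= linear0.
    by have [] := H (x, 0) (tors_pair tx (t0 _ _ _)) dx0.
  have dx0 : res_d pair_resolution 0 (0, x) = 0 by congr pair; rewrite //= linear0.
  by have [] := H (0, x) (tors_pair (t0 _ _ _) tx) dx0.
- move=> [x y] /tors_pairP[tx ty] [dx dy].
  by congr pair; [apply: HI | apply: HJ].
- split=> x tx dx.
    have dx0 : res_d pair_resolution i.+1 (x, 0) = 0 by congr pair; rewrite //= linear0.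
    have [[y z] [/tors_pairP[ty _] [yE _]]] := H (x, 0) (tors_pair tx (t0 _ _ _)) dx0.
    by exists y.
  have dx0 : res_d pair_resolution i.+1 (0, x) = 0 by congr pair; rewrite //= linear0.
  have [[y z] [/tors_pairP[_ tz] [_ zE]]] := H (0, x) (tors_pair (t0 _ _ _) tx) dx0.
  by exists z.
- move=> [x y] /tors_pairP[tx ty] [dx dy].
  have [u [tu uE]] := HI x tx dx; have [v [tv vE]] := HJ y ty dy.
  by exists (u, v); split; [exact: tors_pair | congr pair].
Qed.

End Pair.

Lemma lc_ann_pair (R : comNzRingType) (hR : noetherian_ring R) (m : idealr R)
    (A B : lmodType R) a i :
  a \in lc_ann m (A * B)%type i <-> a \in lc_ann m A i /\ a \in lc_ann m B i.
Proof.
have [I _] := resolution_exists A; have [J _] := resolution_exists B.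
have [xs [_ xsP]] := torsion_tors hR m.
rewrite (lc_annP hR m I) (lc_annP hR m J) (lc_annP hR m (pair_resolution I J)).
by rewrite !(lc_ann_kills _ _ _ xsP) kills_pair.
Qed.

End LcAnn.

(** * Primes and dimension *)

Section FinGen.
Variables (R : comNzRingType) (hR : noetherian_ring R).

(** Induction on the number of generators of [V]: generators of the ideal of first coefficients of
    elements of [A] are lifted to [A], and completed by generators of the elements of [A]
    expressible without the first generator. *)
Lemma fin_gen_sub (V : lmodType R) : fin_gen (predT : {pred V}) ->
  forall A : submodClosed V, fin_gen A.
Proof.
(* The generators need not lie in [A]; only this weaker property passes to the submodule [A'] used
   in the induction. *)
move=> [n [g [_ gP]]] A; have {}gP x : x \in A -> exists c, x = \sum_(i < n) c i *: g i.
  by move=> _; apply: gP.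
elim: n g A gP => [|n IHn] g A gP.
  exists 0%N, (fun=> 0); split=> [[]//|x /gP[c ->]].
  by exists c; rewrite !big_ord0.
pose tail (c : 'I_n -> R) := \sum_(i < n) c i *: g (lift ord0 i).
have tail_lin a c d : tail (fun i => a * c i + d i) = a *: tail c + tail d.
  rewrite /tail scaler_sumr -big_split; apply: eq_bigr => i _.
  by rewrite scalerDl scalerA.
have tail0 : tail (fun=> 0) = 0 by rewrite /tail big1 // => i _; rewrite scale0r.
have [||I IP] := @submod_of R R^o
    (fun a => exists2 x, x \in A & exists c, x = (a : R) *: g ord0 + tail c).
- by exists 0; [exact: rpred0 | exists (fun=> 0); rewrite tail0 addr0 scale0r].
- move=> a b b' [x xA [c xE]] [y yA [d yE]].
  exists (a *: x + y); first by rewrite rpredD ?rpredZ.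
  exists (fun i => a * c i + d i).
  by rewrite tail_lin xE yE scalerDr addrACA regular_scaleE scalerDl scalerA.
have [||A' A'P] := @submod_of R V (fun x => x \in A /\ exists c, x = tail c).
- by rewrite rpred0; split=> //; exists (fun=> 0).
- move=> a x y [xA [c xE]] [yA [d yE]]; split; first by rewrite rpredD ?rpredZ.
  by exists (fun i => a * c i + d i); rewrite tail_lin xE yE.
have [r [h [hI Ih]]] := hR I.
have [r' [g' [g'A Ag']]] : fin_gen A' by apply: (IHn (fun i => g (lift ord0 i))) => x /A'P[].
have /choice [w wP] : forall j, exists x, x \in A /\ exists c, x = (h j : R) *: g ord0 + tail c.
  by move=> j; have /IP[x xA xE] := hI j; exists x.
exists (r + r')%N, (fun k : 'I_(r + r') =>
  match fintype.split k with inl j => w j | inr j => g' j end).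
split=> [k|x xA].
  case: (fintype.split k) => j; first by have [] := wP j.
  by have /A'P[] := g'A j.
have [c xE] := gP x xA; rewrite big_ord_recl in xE.
have /Ih[d dE] : c ord0 \in I by apply/IP; exists x => //; exists (fun i => c (lift ord0 i)).
have /Ag'[d' d'E] : x - \sum_(j < r) d j *: w j \in A'.
  apply/A'P; split.
    by apply: submodB => //; apply: rpred_sum => j _; apply: rpredZ; have [] := wP j.
  have /choice [e eP] : forall j, exists c, w j = (h j : R) *: g ord0 + tail c.
    by move=> j; have [] := wP j.
  exists (fun i => c (lift ord0 i) - \sum_(j < r) d j * e j i).
  under eq_bigr do rewrite eP scalerDr.
  rewrite big_split /= opprD addrA.
  have -> : \sum_(j < r) d j *: (h j *: g ord0) = c ord0 *: g ord0.
    by rewrite dE scaler_suml; apply: eq_bigr => j _; rewrite scalerA.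
  rewrite {1}xE [c ord0 *: _ + _]addrC addrK /tail.
  under [RHS]eq_bigr do rewrite scalerBl scaler_suml.
  rewrite sumrB; congr (_ - _); rewrite exchange_big; apply: eq_bigr => j _.
  by rewrite scaler_sumr; apply: eq_bigr => i _; rewrite scalerA.
exists (fun k : 'I_(r + r') => match fintype.split k with inl j => d j | inr j => d' j end).
rewrite big_split_ord /= -[LHS](subrK (\sum_(j < r) d j *: w j)) d'E [LHS]addrC.
congr (_ + _); apply: eq_bigr => j _.
  case: fintype.splitP => k /= kE; first by rewrite (val_inj kE).
  by have := ltn_ord j; rewrite kE ltnNge leq_addr.
case: fintype.splitP => k /= kE.
  by have := ltn_ord k; rewrite -kE ltnNge leq_addr.
by have /val_inj -> := addnI kE.
Qed.

End FinGen.

Section Primes.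
Variables (R : comNzRingType) (hR : noetherian_ring R).

(** An ideal maximal among those without powers of [a] is prime: if it contained neither [b] nor
    [c], adding either would bring in a power of [a], and the product of these powers would lie in
    the ideal as soon as b c does. *)
Lemma prime_avoiding (A : submodClosed R^o) (a : R) :
    (forall k, a ^+ k \notin A) ->
  exists P : prime_idealr R, {subset A <= P} /\ a \notin P.
Proof.
move=> /(@noetherian_max R hR (fun B => forall k, a ^+ k \notin B))[B [Ba AB Bmax]].
have BM (b c : R) : c \in B -> b * c \in B by move=> cB; apply: (@rpredZ _ _ B).
have BD (b c : R) : b \in B -> c \in B -> b + c \in B by move=> bB cB; apply: (@rpredD _ B).
have B0 : (0 : R) \in B by exact: (rpred0 B).
have [||||P PP] := @prime_of R (fun b => b \in B).
- exact: B0.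
- by apply/negP; have := Ba 0%N; rewrite expr0.
- by move=> b x y xB yB; apply: (BD) => //; apply: (BM).
- move=> b c bcB; apply: contrapT => /not_orP[bB cB].
  have add (d : R) : d \notin B -> exists k n r, n \in B /\ a ^+ k = n + r * d.
    move=> dB; have [||C CP] := @submod_of R R^o (fun x => exists n r, n \in B /\ x = n + r * d).
    - by exists 0, 0; rewrite rpred0 mul0r addr0.
    - move=> s _ _ [n [r [nB ->]]] [n' [r' [nB' ->]]].
      exists (s * n + n'), (s * r + r'); split; first by apply: (BD) => //; apply: (BM).
      by rewrite regular_scaleE mulrDl mulrDr mulrA addrACA.
    apply: contrapT => nk; have /negP := dB; apply; apply: (Bmax C).
    + move=> k; apply/negP => /CP[n [r nr]]; apply: nk; by exists k, n, r.
    + by move=> x xB; apply/CP; exists x, 0; rewrite mul0r addr0.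
    + by apply/CP; exists 0, 1; rewrite rpred0 mul1r add0r.
  have [k [n [r [nB kE]]]] := add b (introN idP bB).
  have [l [n' [r' [nB' lE]]]] := add c (introN idP cB).
  have /negP := Ba (k + l)%N; apply; rewrite exprD lE mulrDr; apply: (BD); first exact: BM.
  rewrite kE mulrDl; apply: (BD); first by rewrite mulrC; apply: (BM).
  by rewrite mulrACA; apply: (BM).
exists P; split=> [b /AB bB|]; first exact/PP.
by apply/negP => /PP; apply/negP; have := Ba 1%N; rewrite expr1.
Qed.

Variables (m : idealr R) (hm : local_ring m).

(** [local_ring] constrains only maximal ideals; the chain condition provides one above [J], and
    uniqueness makes it [m]. *)
Lemma local_sub (J : idealr R) : {subset J <= m}.
Proof.
have [A AE] := idealr_submod J.
have [|B [B1 AB Bmax]] := @noetherian_max R hR (fun B => (1 : R) \notin B) A.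
  by rewrite AE; apply/negP; rewrite idealr1.
have [M ME] := submod_idealr B1.
have M_max : maximal_ideal M.
  move=> K MK x xK; rewrite ME; have [C CE] := idealr_submod K.
  apply: (Bmax C); first by rewrite CE idealr1.
    by move=> y yB; rewrite CE; apply: MK; rewrite ME.
  by rewrite CE.
by move=> x xJ; rewrite -(hm.2 _ M_max) ME AB // AE.
Qed.

(** An element outside [m] is a unit, since otherwise the ideal it generates would be proper and lie
    in [m]. *)
Lemma local_prime : exists P : prime_idealr R, P =i m.
Proof.
have [||||P PP] := @prime_of R (fun a => a \in m).
- exact: rpred0.
- by rewrite idealr1.
- by move=> a x y xm ym; rewrite rpredD // idealMr.
- move=> a b abm; apply: contrapT => /not_orP[am bm].
  have [u uE] : exists u, u * a = 1.
    apply: contrapT => nu; have [|||J JP] := @idealr_of R (fun x => exists u, x = u * a).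
    - by exists 0; rewrite mul0r.
    - by move=> [u uE]; apply: nu; exists u.
    - by move=> c _ _ [u ->] [v ->]; exists (c * u + v); rewrite mulrDl mulrA.
    by apply/am/(@local_sub J)/JP; exists 1; rewrite mul1r.
  by apply: bm; rewrite -[b]mul1r -uE -mulrA idealMr.
by exists P => x; apply/idP/idP => /PP.
Qed.

End Primes.

(** * Krull dimension through chains of primes *)

Section Supremum.
Local Open Scope classical_set_scope.
Local Open Scope ereal_scope.

(** [supremum] picks a least upper bound when there is one, so one has to be exhibited for nonempty
    [T]: the maximum if [T] is bounded, and [+oo] otherwise. The condition on -1 accounts for the
    default value on the empty set. *)
Lemma supremum_natP (T : nat -> Prop) (e : \bar int) :
  supremum (-1)%:E [set n%:Z%:E | n in T] <= e <->
  (-1)%:E <= e /\ forall n, T n -> n%:Z%:E <= e.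
Proof.
set A := (X in supremum _ X); have [T0|/existsNP[n0 /contrapT Tn0]] := pselect (forall n, ~ T n).
  have -> : A = set0 by rewrite -subset0 => x [n /T0].
  by rewrite supremum0; split=> [? | []] //; split=> // n /T0.
have [s [As sA]] : exists s, ubound A s /\ forall u, ubound A u -> s <= u.
  have [[N TN]|unb] := pselect (exists N, forall n, T n -> (n <= N)%N).
    have ex : exists n, `[< T n >] by exists n0; apply/asboolP.
    have bd n : `[< T n >] -> (n <= N)%N by move=> /asboolP /TN.
    have [n /asboolP Tn nmax] := ex_maxnP ex bd; exists n%:Z%:E; split=> [_ [k Tk <-]|u uA].
      by rewrite lee_fin lez_nat; apply/nmax/asboolP.
    by apply: uA; exists n.
  exists +oo; split=> [x _|u uA]; first exact: leey.
  case: u uA => [z|//|] uA.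
  - exfalso; apply: unb; exists `|z|%N => n Tn.
    have : n%:Z%:E <= z%:E by apply: uA; exists n.
    by rewrite lee_fin -lez_nat abszE => /le_trans; apply; apply: ler_norm.
  - by have : n0%:Z%:E <= -oo by apply: uA; exists n0.
have -> : supremum (-1)%:E A = s.
  rewrite /supremum; case: ifP => [/eqP A0|_].
    have : A n0%:Z%:E by exists n0.
    by rewrite A0.
  case: xgetP => [x _ xA|/(_ s) []]; last by split.
  exact: (@is_subset1_supremums _ _ A).
split=> [se|[_ eP]]; last by apply: sA => _ [n /eP ? <-].
have le_e n : T n -> n%:Z%:E <= e by move=> Tn; apply: le_trans se; apply: As; exists n.
split=> //; apply: le_trans (le_e _ Tn0); by rewrite lee_fin.
Qed.

End Supremum.

Section Dimension.
Variable R : comNzRingType.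
Implicit Types (I J : {pred R}) (e : \bar int).

Lemma dim_quot_le I e : (dim_quot I <= e)%E <->
  ((-1)%:E <= e)%E /\ forall n, prime_chain I n -> (n%:Z%:E <= e)%E.
Proof. exact: supremum_natP. Qed.

Lemma dim_quot_ge I : ((-1)%:E <= dim_quot I)%E.
Proof. by have /dim_quot_le[] := lexx (dim_quot I). Qed.

Lemma chain_le_dim I n : prime_chain I n -> (n%:Z%:E <= dim_quot I)%E.
Proof. by have /dim_quot_le[_] := lexx (dim_quot I); apply. Qed.

Lemma prime_chain_sub I n (P : 'I_n.+1 -> prime_idealr R) :
    {subset I <= P ord0} ->
    (forall i j : 'I_n.+1, (i < j)%N -> {subset P i <= P j} /\ ~ {subset P j <= P i}) ->
  prime_chain I n.
Proof.
move=> IP inc; exists P; split=> // i x /IP xP.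
have [->//|i0] := eqVneq i ord0.
have /inc[sub _] : ((ord0 : 'I_n.+1) < i)%N by rewrite lt0n.
exact: sub.
Qed.

(** A chain lies above an ideal as soon as its first prime does, so bounding a dimension reduces to
    finding, below each prime over [I], some ideal of the family [Js]. *)
Lemma prime_chain_cover I n (Js : {pred R} -> Prop) :
    (forall P : prime_idealr R, {subset I <= P} -> exists2 J, Js J & {subset J <= P}) ->
  prime_chain I n -> exists2 J, Js J & prime_chain J n.
Proof.
move=> cover [P [IP inc]]; have [J JsJ JP] := cover (P ord0) (IP _).
by exists J => //; apply: prime_chain_sub inc.
Qed.

Lemma dim_quot_cover I e (Js : {pred R} -> Prop) : ((-1)%:E <= e)%E ->
    (forall P : prime_idealr R, {subset I <= P} -> exists2 J, Js J & {subset J <= P}) ->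
    (forall J, Js J -> (dim_quot J <= e)%E) ->
  (dim_quot I <= e)%E.
Proof.
move=> e1 cover Jse; apply/dim_quot_le; split=> // n.
by move=> /(prime_chain_cover cover)[J /Jse Je /chain_le_dim] /le_trans; apply.
Qed.

Lemma dim_quot_mono I J :
    (forall P : prime_idealr R, {subset I <= P} -> {subset J <= P}) ->
  (dim_quot I <= dim_quot J)%E.
Proof.
move=> IJ; apply: (@dim_quot_cover _ _ (fun K => K = J)) => [|P /IJ|_ ->//].
  exact: dim_quot_ge.
by exists J.
Qed.

Lemma dim_quot_subset I J : {subset J <= I} -> (dim_quot I <= dim_quot J)%E.
Proof. by move=> JI; apply: dim_quot_mono => P IP x /JI /IP. Qed.

Lemma dim_quot_proper I e : 1 \in I -> (dim_quot I <= e)%E = ((-1)%:E <= e)%E.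
Proof.
move=> I1; apply/idP/idP => [/dim_quot_le[]//|e1]; apply/dim_quot_le; split=> // n.
by move=> [P [/(_ ord0 _ I1)]]; rewrite idealr1.
Qed.

(** The family is finite so that the largest of its dimensions is still strictly below [e], even for
    [e = +oo]. *)
Lemma dim_quot_lt_cover I e r (J : 'I_r -> {pred R}) : ((-1)%:E < e)%E ->
    (forall P : prime_idealr R, {subset I <= P} -> exists i, {subset J i <= P}) ->
    (forall i, (dim_quot (J i) < e)%E) ->
  (dim_quot I < e)%E.
Proof.
move=> e1 cover Je; pose e' := \big[Order.max/(-1)%:E]_(i < r) dim_quot (J i).
apply: (@le_lt_trans _ _ e'); last exact: bigmax_lt.
apply: (@dim_quot_cover _ _ (fun K => exists i, K = J i)).
- exact: bigmax_ge_id.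
- by move=> P /cover[i iP]; exists (J i) => //; exists i.
- by move=> _ [i ->]; apply: le_bigmax.
Qed.

Section Annihilator.
Variable V : lmodType R.

Definition ann1 (v : V) : {pred R} := [pred a | a *: v == 0].

(** Otherwise each [g i] is killed by some [b i] outside [P], and the product of these annihilates
    [A] while staying outside [P]. *)
Lemma prime_ann_gen (P : prime_idealr R) (A : {pred V}) r (g : 'I_r -> V) :
    (forall x, x \in A -> exists c : 'I_r -> R, x = \sum_(i < r) c i *: g i) ->
    {subset ann A <= P} ->
  exists i, {subset ann1 (g i) <= P}.
Proof.
move=> gA AP; apply: contrapT => nP.
have /choice [b bP] : forall i, exists b, b *: g i = 0 /\ b \notin P.
  move=> i; apply: contrapT => nb; apply: nP; exists i => a /eqP ag.
  by apply: contrapT => /negP aP; apply: nb; exists a.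
have /AP : \prod_i b i \in ann A.
  apply/asboolP => x /gA[c ->]; rewrite scaler_sumr big1 // => i _.
  by rewrite scalerA mulrC -scalerA (bigD1 i) //= mulrC -scalerA (bP i).1 !scaler0.
apply/negP; elim/big_rec: _ => [|i a _ aP]; first by rewrite idealr1.
by rewrite prime_idealrM negb_or (bP i).2.
Qed.

Lemma ann_ann1 (A : {pred V}) v : v \in A -> {subset ann A <= ann1 v}.
Proof. by move=> vA a /asboolP aA; apply/eqP/aA. Qed.

Lemma dim_ann1_le (A : {pred V}) v : v \in A -> (dim_quot (ann1 v) <= dim_mod A)%E.
Proof. by move=> vA; apply/dim_quot_subset/ann_ann1. Qed.

Lemma dim_mod_lt (A : submodClosed V) e : fin_gen A -> ((-1)%:E < e)%E ->
  (forall v, v \in A -> (dim_quot (ann1 v) < e)%E) -> (dim_mod A < e)%E.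
Proof.
move=> [r [g [gA Ag]]] e1 Ae.
apply: (@dim_quot_lt_cover _ _ r (fun i => ann1 (g i))) => // [P AP|i].
  exact: prime_ann_gen Ag AP.
exact/Ae/gA.
Qed.

Lemma dim_mod_le (A : submodClosed V) e : fin_gen A -> ((-1)%:E <= e)%E ->
  (forall v, v \in A -> (dim_quot (ann1 v) <= e)%E) -> (dim_mod A <= e)%E.
Proof.
move=> [r [g [gA Ag]]] e1 Ae.
apply: (@dim_quot_cover _ _ (fun K => exists i, K = ann1 (g i))) => // [P AP|_ [i ->]].
  by have [i iP] := prime_ann_gen Ag AP; exists (ann1 (g i)) => //; exists i.
exact/Ae/gA.
Qed.

(** If [b] outside [P] kills [v] and [c] kills [w], then [b * c] kills the combination. This makes
    the dimension levels submodules. *)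
Lemma prime_ann1P (P : prime_idealr R) v w a :
    {subset ann1 (a *: v + w) <= P} -> {subset ann1 v <= P} \/ {subset ann1 w <= P}.
Proof.
move=> vwP; have [?|nv] := pselect {subset ann1 v <= P}; first by left.
right=> c /eqP cw; move/existsNP: nv => [b /not_implyP[/eqP bv bP]].
have : b * c \in P.
  apply: vwP; rewrite inE scalerDr.
  have -> : (b * c) *: w = 0 by rewrite -scalerA cw scaler0.
  have -> : (b * c) *: (a *: v) = (c * a) *: (b *: v).
    by rewrite !scalerA [b * c]mulrC mulrAC.
  by rewrite bv scaler0 addr0.
by rewrite prime_idealrM => /orP[].
Qed.

Lemma dim_ann1_lt_sub e : ((-1)%:E < e)%E -> exists A : submodClosed V,
  forall v, v \in A <-> (dim_quot (ann1 v) < e)%E.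
Proof.
move=> e1; apply: submod_of => [|a v w ve we].
  by apply: le_lt_trans e1; rewrite dim_quot_proper // inE scaler0.
apply: (@dim_quot_lt_cover _ _ 2 (fun i => if i == ord0 then ann1 v else ann1 w)) => //.
  by move=> P /prime_ann1P[vP|wP]; [exists ord0 | exists ord_max].
by move=> i; case: ifP.
Qed.

Lemma dim_ann1_le_sub e : ((-1)%:E <= e)%E -> exists A : submodClosed V,
  forall v, v \in A <-> (dim_quot (ann1 v) <= e)%E.
Proof.
move=> e1; apply: submod_of => [|a v w ve we].
  by rewrite dim_quot_proper // inE scaler0.
apply: (@dim_quot_cover _ _ (fun K => K = ann1 v \/ K = ann1 w)) => // [|_ [] ->//].
by move=> P /prime_ann1P[vP|wP]; [exists (ann1 v) | exists (ann1 w)]; auto.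
Qed.

End Annihilator.

(** If powers of the elements of [m] kill [v], every prime over the annihilator contains [m], and no
    chain has two members. Conversely, if no power of some x in [m] kills [v], a prime over the
    annihilator avoiding [x] lies strictly below [m], which gives a chain of length 1. *)
Lemma torsion_dim (hR : noetherian_ring R) (m : idealr R) (hm : local_ring m)
    (V : lmodType R) (v : V) :
  v \in torsion m V <-> (dim_quot (ann1 v) <= 0%:E)%E.
Proof.
have [M ME] := local_prime hR hm.
split=> [tv | dv].
  apply/dim_quot_le; split=> // -[|n] [P [vP inc]] //.
  have [_ nsub] := inc ord0 ord_max isT; exfalso; apply: nsub => x xP.
  suff xm : x \in m.
    have [k xk] := torsion_exp xm tv.
    have : x ^+ k \in P ord0 by apply: vP; apply/eqP.
    elim: k {xk} => [|k IHk]; first by rewrite expr0 idealr1.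
    by rewrite exprS prime_idealrM => /orP[].
  exact: (@local_sub R hR m hm (P ord_max)).
have [xs [xsm xsP]] := torsion_tors hR m; apply/xsP => x /xsm xm.
apply: contrapT => nx.
have [||A AP] := @submod_of R R^o (fun a : R => a *: v = 0).
- by rewrite scale0r.
- by move=> a b c bv cv; rewrite scalerDl cv addr0 regular_scaleE -scalerA bv scaler0.
have [|P [AsubP xP]] := @prime_avoiding R hR A x.
  by move=> k; apply/negP => /AP xk; apply: nx; exists k.
suff /chain_le_dim : prime_chain (ann1 v) 1 by move=> /le_trans /(_ dv).
apply: (@prime_chain_sub _ 1 (fun i => if i == ord0 then P else M)) => [a /eqP av|i j].
  by apply: AsubP; apply/AP.
case: i => -[|[]] // ? ; case: j => -[|[]] // ? _ /=; split=> [a aP|].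
  by rewrite ME; apply: (@local_sub R hR m hm P).
by move=> /(_ x); rewrite ME xm (negPf xP) => /(_ isT).
Qed.

End Dimension.

(** * Dimension filtrations *)

Section DimCM.
Variables (R : comNzRingType) (hR : noetherian_ring R) (m : idealr R).

Lemma prime_idealM (P : prime_idealr R) (I J : {pred R}) :
  {subset idealM I J <= P} <-> {subset I <= P} \/ {subset J <= P}.
Proof.
split=> [IJP|IJP _ /asboolP[s [sP ->]]].
  have [?|nI] := pselect {subset I <= P}; first by left.
  right=> b bJ; move/existsNP: nI => [a /not_implyP[aI aP]].
  have : a * b \in P.
    apply: IJP; apply/asboolP; exists [:: (a, b)].
    by split=> [p|]; rewrite ?big_seq1 // inE => /eqP ->.
  by rewrite prime_idealrM => /orP[].
rewrite big_seq; apply: rpred_sum => p /sP[p1 p2]; rewrite prime_idealrM.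
by case: IJP => [/(_ _ p1) ->|/(_ _ p2) ->]; rewrite ?orbT.
Qed.

Lemma prime_idealM_big (P : prime_idealr R) n (F : nat -> {pred R}) :
  {subset \big[@idealM R/(predT : {pred R})]_(i < n) F i <= P} <->
  exists i, (i < n)%N /\ {subset F i <= P}.
Proof.
elim: n F => [|n IHn] F.
  rewrite big_ord0; split=> [/(_ 1 isT)|[i []//]]; by rewrite idealr1.
rewrite big_ord_recl prime_idealM (IHn (fun i => F i.+1)).
split=> [[?|[i [i_n iP]]]|[[|i] [i_n iP]]]; [by exists 0%N | by exists i.+1 | by left |].
by right; exists i.
Qed.

Lemma prime_lc_ann_prod (P : prime_idealr R) (M : lmodType R) :
  {subset lc_ann_prod m M <= P} <->
  exists i, (i < int_dim M)%N /\ {subset lc_ann m M i <= P}.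
Proof. exact: prime_idealM_big. Qed.

Lemma int_dim_eq (M N : lmodType R) :
  dim_mod (predT : {pred M}) = dim_mod (predT : {pred N}) -> int_dim M = int_dim N.
Proof. by rewrite /int_dim => ->. Qed.

Lemma dimCM_zero (k : int) (M : lmodType R) :
  (-1 <= k) -> (forall x : M, x = 0) -> dimCM m k M.
Proof.
move=> k1 M0; have d1 : (dim_mod (predT : {pred M}) <= (-1)%:E)%E.
  rewrite /dim_mod dim_quot_proper //; apply/asboolP => x _.
  exact: M0.
rewrite /dimCM; suff d0 : int_dim M = 0%N.
  by rewrite /lc_ann_prod d0 big_ord0 dim_quot_proper // lee_fin.
by move: d1; rewrite /int_dim; move: (dim_mod _) => [[]||].
Qed.

Section Iso.
Variables (M N : lmodType R) (phi : M -> N).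
Hypothesis phiL : forall a x y, phi (a *: x + y) = a *: phi x + phi y.
Hypotheses (phi_inj : injective phi) (phi_surj : forall y, exists x, phi x = y).

Lemma dim_mod_iso : dim_mod (predT : {pred M}) = dim_mod (predT : {pred N}).
Proof.
have phi0 : phi 0 = 0.
  by have := phiL (-1) 0 0; rewrite scaler0 addr0 scaleN1r addNr.
have phiZ a x : phi (a *: x) = a *: phi x.
  by have := phiL a x 0; rewrite !addr0 phi0 addr0.
have annE : ann (predT : {pred M}) =i ann (predT : {pred N}).
  move=> a; apply/asboolP/asboolP => aM x _.
    by have [y <-] := phi_surj x; rewrite -phiZ aM.
  by apply: phi_inj; rewrite phiZ aM ?phi0.
by apply/eqP; rewrite eq_le /dim_mod !dim_quot_subset // => a; rewrite annE.
Qed.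

Lemma dimCM_iso (k : int) : dimCM m k M <-> dimCM m k N.
Proof.
have dE := int_dim_eq dim_mod_iso.
have lcE := lc_ann_iso hR m phiL phi_inj phi_surj.
by split; apply: le_trans; apply: dim_quot_mono => P /prime_lc_ann_prod[i [id iP]];
  apply/prime_lc_ann_prod; exists i; rewrite ?dE // in id *; split=> // a /lcE; apply: iP.
Qed.

End Iso.

(** A prime over the intersection of two annihilators contains one of them. Equal values of
    [int_dim] make the three products run over the same degrees. *)
Lemma dimCM_pair (k : int) (M N : lmodType R) : (-1 <= k) ->
    int_dim M = int_dim (M * N)%type -> int_dim N = int_dim (M * N)%type ->
  dimCM m k (M * N)%type <-> dimCM m k M /\ dimCM m k N.
Proof.
move=> k1 dM dN; have lcE := lc_ann_pair hR m M N.
split=> [MN|[Mk Nk]].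
  by split; apply: le_trans MN; apply: dim_quot_mono => P /prime_lc_ann_prod[i [id iP]];
    apply/prime_lc_ann_prod; exists i; rewrite ?dM ?dN in id; split=> // a /lcE[aM aN]; apply: iP.
apply: (@dim_quot_cover _ _ _ (fun K => K = lc_ann_prod m M \/ K = lc_ann_prod m N)) => //.
  move=> P /prime_lc_ann_prod[i [id iP]].
  have [MP|nMP] := pselect {subset lc_ann m M i <= P}.
    exists (lc_ann_prod m M); first by left.
    by apply/prime_lc_ann_prod; exists i; rewrite dM.
  exists (lc_ann_prod m N); first by right.
  apply/prime_lc_ann_prod; exists i; rewrite dN; split=> // b bN.
  move/existsNP: nMP => [a /not_implyP[aM aP]].
  have : a * b \in P by apply/iP/lcE; split; [rewrite mulrC|]; apply: lc_annM.
  by rewrite prime_idealrM => /orP[].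
by move=> _ [] ->.
Qed.

End DimCM.

(** Semilinearity lets this serve both over a fixed ring, with [f] the identity, and for the passage
    from [R] to the idealization. *)
Lemma subquot_transfer (R S : comNzRingType) (f : {rmorphism R -> S})
    (V : lmodType R) (W : lmodType S) (theta : V -> W)
    (A' B' : submodClosed V) (A B : submodClosed W) :
    (forall a x y, theta (a *: x + y) = f a *: theta x + theta y) ->
    (forall v, v \in A' -> theta v \in A) ->
    (forall w, w \in A -> exists2 v, v \in A' & theta v = w) ->
    (forall v, v \in A' -> v \in B' <-> theta v \in B) ->
  exists phi : subquot A' B' -> subquot A B,
    [/\ forall a x y, phi (a *: x + y) = f a *: phi x + phi y,
        injective phi & forall y, exists x, phi x = y].
Proof.
move=> thL thA thS thB.
have thB2 u v : theta (u - v) = theta u - theta v.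
  by rewrite addrC -scaleN1r thL rmorphN1 scaleN1r addrC.
pose th (u : submodule A') := Submodule (thA _ (valP u)).
have /choice [s sP] : forall q : subquot A' B', exists u, subquot_pi B' u = q.
  exact: subquot_pi_surj.
pose phi q := subquot_pi B (th (s q)).
have phi_pi u : phi (subquot_pi B' u) = subquot_pi B (th u).
  apply/subquot_pi_eq => /=; rewrite -thB2; apply/thB.
    by apply: submodB; apply: valP.
  by apply/subquot_pi_eq; rewrite sP.
exists phi; split=> [a x y|x y|y].
- rewrite -[x]sP -[y]sP -subquot_pi_linear !phi_pi -subquot_pi_linear.
  by congr subquot_pi; apply: val_inj; rewrite /= thL.
- rewrite -[x]sP -[y]sP !phi_pi => /subquot_pi_eq /=; rewrite -thB2 => xyB.
  by apply/subquot_pi_eq/thB => //; apply: submodB; apply: valP.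
have [[w wA] <-] := subquot_pi_surj y; have [v vA vw] := thS w wA.
exists (subquot_pi B' (Submodule vA)); rewrite phi_pi; congr subquot_pi.
exact: val_inj.
Qed.

(** * Sequential conditions in terms of dimension levels *)

Section Strata.
Variables (R : comNzRingType) (hR : noetherian_ring R) (m : idealr R) (hm : local_ring m).

(* The dimension filtration read off level by level: [A / B] is zero unless [A]
   is some [D_i], and then [B] is [D_i.+1]. *)
Definition strata_dimCM (k : int) (V : lmodType R) : Prop :=
  forall e : \bar int, (0%:E < e)%E -> forall A B : submodClosed V,
    (forall v, v \in A <-> (dim_quot (ann1 v) <= e)%E) ->
    (forall v, v \in B <-> (dim_quot (ann1 v) < e)%E) ->
  dimCM m k (subquot A B).

Section Levels.
Variables (V : lmodType R) (hV : fin_gen (predT : {pred V})).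

Lemma subquot_zero (A B : submodClosed V) : {subset A <= B} ->
  forall x : subquot A B, x = 0.
Proof.
move=> AB x; have [u <-] := subquot_pi_surj x.
by apply/subquot_pi_eq0/AB/valP.
Qed.

(** The annihilators of [B] and of A/B multiply into that of [A]. As [B] has dimension below [e], a
    quotient of dimension below [e] would force the same for [A], hence for all its elements, which
    would then lie in [B]. *)
Lemma level_dim e (A B : submodClosed V) : (0%:E < e)%E ->
    (forall v, v \in A <-> (dim_quot (ann1 v) <= e)%E) ->
    (forall v, v \in B <-> (dim_quot (ann1 v) < e)%E) ->
    ~ {subset A <= B} ->
  dim_mod (predT : {pred subquot A B}) = e.
Proof.
move=> e0 AP BP AB.
have e1 : ((-1)%:E < e)%E by apply: lt_trans e0.
apply/eqP; rewrite eq_le; apply/andP; split.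
  apply: (@le_trans _ _ (dim_mod A)).
    apply: dim_quot_subset => a /asboolP aA; apply/ann_subquot => x xA.
    by rewrite aA ?rpred0.
  by apply: dim_mod_le (ltW e1) _ => [|v /AP//]; apply: fin_gen_sub.
rewrite leNgt; apply/negP => Qe; apply: AB => x xA; apply/BP.
apply: le_lt_trans (dim_ann1_le xA) _.
apply: (@dim_quot_lt_cover _ _ _ 2
  (fun i => if i == ord0 then ann (predT : {pred subquot A B}) else ann B)) => // [P AnnP|i].
  have [?|nQ] := pselect {subset ann (predT : {pred subquot A B}) <= P}; first by exists ord0.
  exists ord_max => b /asboolP bB.
  move/existsNP: nQ => [a /not_implyP[/ann_subquot aQ aP]].
  have : b * a \in P.
    by apply: AnnP; apply/asboolP => y yA; rewrite -scalerA bB // aQ.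
  by rewrite prime_idealrM => /orP[].
case: ifP => // _; apply: dim_mod_lt e1 _ => [|v /BP//]; exact: fin_gen_sub.
Qed.

(** The filtration starts at [A] instead of the whole module, so that it can be built by recursion
    on the dimension of [A]. *)
Definition has_filtration (k : int) (A : submodClosed V) : Prop :=
  exists t (D : nat -> submodClosed V),
    [/\ D 0 = A, D t =i torsion m V,
        forall i, (i < t)%N -> {subset D i.+1 <= D i} /\ ~ {subset D i <= D i.+1},
        forall i, (i < t)%N -> is_largest_lt (dim_mod (D i)) (D i.+1) &
        forall i, (i < t)%N -> dimCM m k (subquot (D i) (D i.+1))].

(** Invariant of the recursion: [A] is a full dimension level, and it contains the torsion, at which
    the filtration has to end even when that is all of [A]. *)
Definition saturated (A : submodClosed V) : Prop := forall v,
  (dim_quot (ann1 v) <= dim_mod A)%E \/ (dim_quot (ann1 v) <= 0%:E)%E -> v \in A.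

Lemma has_filtration_step k (A : submodClosed V) : strata_dimCM k V -> saturated A ->
    (0%:E < dim_mod A)%E ->
    (forall B : submodClosed V, (dim_mod B < dim_mod A)%E -> saturated B -> has_filtration k B) ->
  has_filtration k A.
Proof.
move=> Vk Asat A0 IH; have A1 : ((-1)%:E < dim_mod A)%E by apply: lt_trans A0.
have [B BP] := dim_ann1_lt_sub V A1.
have AP v : v \in A <-> (dim_quot (ann1 v) <= dim_mod A)%E.
  by split=> [/dim_ann1_le //|vA]; apply: Asat; left.
have BA : (dim_mod B < dim_mod A)%E.
  by apply: dim_mod_lt A1 _ => [|v /BP//]; apply: fin_gen_sub.
have [|t [D [D0 Dt Dsub Dmax Dk]]] := IH B BA.
  move=> v [vB|v0]; apply/BP; first exact: le_lt_trans BA.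
  exact: le_lt_trans A0.
exists t.+1, (fun i => if i is j.+1 then D j else A); split=> //.
- case=> [_|i /Dsub//]; rewrite D0; split=> [v /BP vA|AB]; first by apply/AP/ltW.
  suff : (dim_mod A <= dim_mod B)%E by rewrite leNgt BA.
  by apply: dim_quot_subset => a /asboolP aB; apply/asboolP => x /AB /aB.
- case=> [_|i /Dmax//]; rewrite D0; split=> // B' B'A v vB'; apply/BP.
  exact: le_lt_trans (dim_ann1_le vB') B'A.
- by case=> [_|i /Dk//]; rewrite D0; apply: Vk A0 _ _ AP BP.
Qed.

Lemma has_filtration_small k n (A : submodClosed V) : strata_dimCM k V -> saturated A ->
  (dim_mod A < n%:Z%:E)%E -> has_filtration k A.
Proof.
move=> Vk; elim: n A => [|n IHn] A Asat An; have [A0|A0] := leP (dim_mod A) 0%:E.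
- exists 0%N, (fun=> A); split=> // v; apply/idP/idP => [vA|/(torsion_dim hR hm) v0].
    by apply/(torsion_dim hR hm)/(le_trans (dim_ann1_le vA)).
  by apply: Asat; right.
- by have := lt_trans A0 An; rewrite ltxx.
- exists 0%N, (fun=> A); split=> // v; apply/idP/idP => [vA|/(torsion_dim hR hm) v0].
    by apply/(torsion_dim hR hm)/(le_trans (dim_ann1_le vA)).
  by apply: Asat; right.
apply: has_filtration_step => // B BA Bsat; apply: IHn => //.
apply: lt_le_trans BA _; move: An; by case: (dim_mod A).
Qed.

Lemma seq_dimCM_strata k : (-1 <= k) -> seq_dimCM m k V <-> strata_dimCM k V.
Proof.
move=> k1; split=> [[t [D [[D0 Dt Dsub Dmax] Dk]]] e e0 A B AP BP|Vk]; last first.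
  have [||A AP] := @submod_of R V (fun=> True) => //.
  have AT v : v \in A by apply/AP.
  have sm (B : submodClosed V) : (dim_mod B < +oo)%E -> saturated B -> has_filtration k B.
    move=> Boo Bsat; suff [n Bn] : exists n : nat, (dim_mod B < n%:Z%:E)%E.
      exact: has_filtration_small Bn.
    move: Boo; case: (dim_mod B) => [z _|//|_]; last by exists 0%N.
    by exists `|z|.+1%N; rewrite lte_fin (le_lt_trans (ler_norm z)) // -abszE ltz_nat.
  have Asat : saturated A by move=> v _; apply: AT.
  have [t [D [D0 Dt Dsub Dmax Dk]]] : has_filtration k A.
    (* Recursion on a natural bound handles finite dimension. From the value [+oo] a single step
       leads to a level of smaller, hence finite, dimension. *)
    have [Aoo|] := ltP (dim_mod A) +oo%E; first exact: sm.
    rewrite leye_eq => /eqP Aoo; apply: has_filtration_step => //; rewrite Aoo //.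
  exists t, D; split=> //; split=> // v.
  by rewrite D0 AT.
have e1 : ((-1)%:E < e)%E by apply: lt_trans e0.
have fg := fin_gen_sub hR hV.
have [AB|AB] := pselect {subset A <= B}; first exact/dimCM_zero/subquot_zero.
(* At the last term containing [A], maximality of [D i.+1] forces [D i] to be [A], and then [D i.+1]
   to be [B]. Such an [i] exists because the final term is torsion, hence inside [B]. *)
have [i [it Di Di1]] : exists i, [/\ (i < t)%N, {subset A <= D i} & ~ {subset A <= D i.+1}].
  apply: contrapT => ni; apply: AB => v vA.
  suff /(_ t (leqnn t)) ADt : forall i, (i <= t)%N -> {subset A <= D i}.
    apply/BP; apply: le_lt_trans e0; apply/(torsion_dim hR hm); rewrite -Dt.
    exact: ADt.
  elim=> [_|i IHi it]; first by move=> w _; rewrite D0.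
  by apply: contrapT => nAD; apply: ni; exists i; split=> //; apply/IHi/ltnW.
have [Dlt Dlargest] := Dmax i it.
have die : (dim_mod (D i) <= e)%E.
  rewrite leNgt; apply/negP => eD; apply: Di1; apply: Dlargest.
  by apply: le_lt_trans eD; apply: dim_mod_le (ltW e1) _ => // v /AP.
have DA : {subset D i <= A} by move=> v /dim_ann1_le vD; apply/AP/(le_trans vD).
have dE : dim_mod (D i) = e.
  apply/eqP; rewrite eq_le die leNgt; apply/negP => De; apply: AB => v /Di vD.
  by apply/BP; apply: le_lt_trans De; apply: dim_ann1_le.
have DB v : v \in D i.+1 <-> v \in B.
  split=> [vD|]; last by apply: Dlargest; rewrite dE; apply: dim_mod_lt => // w /BP.
  by apply/BP; apply: le_lt_trans (dim_ann1_le vD) _; rewrite -dE.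
have [||||phi [phiL phi_inj phi_surj]] :=
  @subquot_transfer R R idfun V V id (D i) (D i.+1) A B => //.
  by move=> w /Di wD; exists w.
exact: (@dimCM_iso R hR m _ _ phi phiL phi_inj phi_surj k).1 (Dk i it).
Qed.

End Levels.
End Strata.

(** * Direct sums *)

Section StrataPair.
Variables (R : comNzRingType) (hR : noetherian_ring R) (m : idealr R).

Lemma dim_ann1_pair (U V : lmodType R) (u : U) (v : V) :
  dim_quot (ann1 ((u, v) : (U * V)%type)) = Order.max (dim_quot (ann1 u)) (dim_quot (ann1 v)).
Proof.
apply/eqP; rewrite eq_le; apply/andP; split; last first.
  rewrite ge_max; apply/andP; split; apply: dim_quot_subset => a /eqP[au av].
    by apply/eqP.
  by apply/eqP.
apply: (@dim_quot_cover _ _ _ (fun K => K = ann1 u \/ K = ann1 v)).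
- by rewrite le_max dim_quot_ge.
- have -> : (u, v) = 1 *: ((u, 0) : (U * V)%type) + (0, v).
    by rewrite scale1r; congr pair; rewrite /= ?addr0 ?add0r.
  move=> P /prime_ann1P[uP|vP]; [exists (ann1 u) | exists (ann1 v)]; auto.
    by move=> a /eqP au; apply: uP; apply/eqP; congr pair; rewrite //= scaler0.
  by move=> a /eqP av; apply: vP; apply/eqP; congr pair; rewrite //= scaler0.
- by move=> _ [] ->; rewrite le_max lexx ?orbT.
Qed.

Lemma subquot_pair (U V : lmodType R) (A B : submodClosed (U * V)%type)
    (A1 B1 : submodClosed U) (A2 B2 : submodClosed V) :
    (forall u v, (u, v) \in A <-> u \in A1 /\ v \in A2) ->
    (forall u v, (u, v) \in B <-> u \in B1 /\ v \in B2) ->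
  exists phi : (subquot A1 B1 * subquot A2 B2)%type -> subquot A B,
    [/\ forall a x y, phi (a *: x + y) = a *: phi x + phi y,
        injective phi & forall y, exists x, phi x = y].
Proof.
move=> AE BE.
have memA (u : submodule A1) (v : submodule A2) : (val u, val v) \in A.
  by apply/AE; split; apply: valP.
pose th u v : submodule A := Submodule (memA u v).
have /choice [s sP] : forall q : subquot A1 B1, exists u, subquot_pi B1 u = q.
  exact: subquot_pi_surj.
have /choice [t tP] : forall q : subquot A2 B2, exists u, subquot_pi B2 u = q.
  exact: subquot_pi_surj.
pose phi (q : (subquot A1 B1 * subquot A2 B2)%type) := subquot_pi B (th (s q.1) (t q.2)).
have eqE u v u' v' : subquot_pi B (th u v) = subquot_pi B (th u' v') <->
    subquot_pi B1 u = subquot_pi B1 u' /\ subquot_pi B2 v = subquot_pi B2 v'.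
  by rewrite !subquot_pi_eq -BE.
have phi_pi u v : phi (subquot_pi B1 u, subquot_pi B2 v) = subquot_pi B (th u v).
  by apply/eqE; rewrite /= sP tP.
exists phi; split=> [a [x1 x2] [y1 y2]|[x1 x2] [y1 y2]|y].
- rewrite -[x1]sP -[x2]tP -[y1]sP -[y2]tP.
  have -> : a *: (subquot_pi B1 (s x1), subquot_pi B2 (t x2)) +
      (subquot_pi B1 (s y1), subquot_pi B2 (t y2)) =
      (subquot_pi B1 (a *: s x1 + s y1), subquot_pi B2 (a *: t x2 + t y2)).
    by rewrite !subquot_pi_linear.
  rewrite !phi_pi -subquot_pi_linear; congr subquot_pi; exact: val_inj.
- by rewrite -[x1]sP -[x2]tP -[y1]sP -[y2]tP !phi_pi => /eqE[-> ->].
have [[[u v] uvA] <-] := subquot_pi_surj y; have [uA vA] := (AE u v).1 uvA.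
exists (subquot_pi B1 (Submodule uA), subquot_pi B2 (Submodule vA)).
by rewrite phi_pi; congr subquot_pi; apply: val_inj.
Qed.

Lemma strata_pair (U V : lmodType R) (k : int) : (-1 <= k) ->
    fin_gen (predT : {pred U}) -> fin_gen (predT : {pred V}) ->
    fin_gen (predT : {pred (U * V)%type}) ->
  strata_dimCM m k (U * V)%type <-> strata_dimCM m k U /\ strata_dimCM m k V.
Proof.
move=> k1 hU hV hUV.
suff main e (A B : submodClosed (U * V)%type) (A1 B1 : submodClosed U)
    (A2 B2 : submodClosed V) : (0%:E < e)%E ->
    (forall w, w \in A <-> (dim_quot (ann1 w) <= e)%E) ->
    (forall w, w \in B <-> (dim_quot (ann1 w) < e)%E) ->
    (forall u, u \in A1 <-> (dim_quot (ann1 u) <= e)%E) ->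
    (forall u, u \in B1 <-> (dim_quot (ann1 u) < e)%E) ->
    (forall v, v \in A2 <-> (dim_quot (ann1 v) <= e)%E) ->
    (forall v, v \in B2 <-> (dim_quot (ann1 v) < e)%E) ->
    dimCM m k (subquot A B) <-> dimCM m k (subquot A1 B1) /\ dimCM m k (subquot A2 B2).
  split=> [UV|[Uk Vk] e e0 A B AP BP].
    split=> e e0.
      move=> A1 B1 A1P B1P; have e1 : ((-1)%:E < e)%E by apply: lt_trans e0.
      have [A AP] := dim_ann1_le_sub (U * V)%type (ltW e1).
      have [B BP] := dim_ann1_lt_sub (U * V)%type e1.
      have [A2 A2P] := dim_ann1_le_sub V (ltW e1); have [B2 B2P] := dim_ann1_lt_sub V e1.
      by have [] := (main e A B A1 B1 A2 B2 e0 AP BP A1P B1P A2P B2P).1 (UV e e0 A B AP BP).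
    move=> A2 B2 A2P B2P; have e1 : ((-1)%:E < e)%E by apply: lt_trans e0.
    have [A AP] := dim_ann1_le_sub (U * V)%type (ltW e1).
    have [B BP] := dim_ann1_lt_sub (U * V)%type e1.
    have [A1 A1P] := dim_ann1_le_sub U (ltW e1); have [B1 B1P] := dim_ann1_lt_sub U e1.
    by have [] := (main e A B A1 B1 A2 B2 e0 AP BP A1P B1P A2P B2P).1 (UV e e0 A B AP BP).
  have e1 : ((-1)%:E < e)%E by apply: lt_trans e0.
  have [A1 A1P] := dim_ann1_le_sub U (ltW e1); have [B1 B1P] := dim_ann1_lt_sub U e1.
  have [A2 A2P] := dim_ann1_le_sub V (ltW e1); have [B2 B2P] := dim_ann1_lt_sub V e1.
  apply/(main e A B A1 B1 A2 B2 e0 AP BP A1P B1P A2P B2P).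
  by split; [exact: Uk e0 _ _ A1P B1P | exact: Vk e0 _ _ A2P B2P].
move=> e0 AP BP A1P B1P A2P B2P.
have AE u v : (u, v) \in A <-> u \in A1 /\ v \in A2.
  rewrite AP A1P A2P dim_ann1_pair ge_max; split=> [/andP//|?]; exact/andP.
have BE u v : (u, v) \in B <-> u \in B1 /\ v \in B2.
  rewrite BP B1P B2P dim_ann1_pair gt_max; split=> [/andP//|?]; exact/andP.
have [phi [phiL phi_inj phi_surj]] := subquot_pair AE BE.
have phi0 : phi 0 = 0.
  by have := phiL (-1) 0 0; rewrite scaler0 addr0 scaleN1r addNr.
(* A zero quotient has [int_dim] 0, not that of the sum, so [dimCM_pair] is kept for two nonzero
   quotients, which both have dimension [e]. If one is zero, the sum is isomorphic to the other. *)
have [AB1|AB1] := pselect {subset A1 <= B1}.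
  have z1 := subquot_zero AB1.
  suff : dimCM m k (subquot A2 B2) <-> dimCM m k (subquot A B).
    by move=> <-; split=> [?|[]//]; split=> //; apply: dimCM_zero.
  apply: (@dimCM_iso R hR m _ _ (fun q => phi (0, q))) => [a x y|x y /phi_inj[]//|y].
    by rewrite -phiL; congr phi; congr pair; rewrite /= scaler0 addr0.
  by have [[x1 x2] <-] := phi_surj y; exists x2; rewrite (z1 x1).
have [AB2|AB2] := pselect {subset A2 <= B2}.
  have z2 := subquot_zero AB2.
  suff : dimCM m k (subquot A1 B1) <-> dimCM m k (subquot A B).
    by move=> <-; split=> [?|[]//]; split=> //; apply: dimCM_zero.
  apply: (@dimCM_iso R hR m _ _ (fun q => phi (q, 0))) => [a x y|x y /phi_inj[]//|y].
    by rewrite -phiL; congr phi; congr pair; rewrite /= scaler0 addr0.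
  by have [[x1 x2] <-] := phi_surj y; exists x1; rewrite (z2 x2).
have AB : ~ {subset A <= B}.
  move=> AB; apply: AB1 => u uA; have /AB/BE[] // : (u, 0) \in A.
  by apply/AE; rewrite rpred0.
have dQ := level_dim hR hUV e0 AP BP AB.
have d1 := level_dim hR hU e0 A1P B1P AB1.
have d2 := level_dim hR hV e0 A2P B2P AB2.
have d12 := dim_mod_iso phiL phi_inj phi_surj.
rewrite -(dimCM_iso hR m phiL phi_inj phi_surj).
by apply: dimCM_pair => //; apply: int_dim_eq; rewrite ?d1 ?d2 d12 dQ.
Qed.

End StrataPair.

(** * Idealization *)

Section IdealizationBaseChange.
Variables (R : comNzRingType) (hR : noetherian_ring R) (m : idealr R).
Variables (M : lmodType R) (hM : fin_gen (predT : {pred M})).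
Local Notation S := (idealization M).

Definition idz_in (a : R) : S := (a, 0).

Fact idz_in_zmod : zmod_morphism idz_in.
Proof. by move=> a b; congr pair; rewrite /= ?subr0. Qed.
Fact idz_in_monoid : monoid_morphism idz_in.
Proof. by split=> // a b; rewrite /idz_in idz_prodE !scaler0 addr0. Qed.
HB.instance Definition _ := GRing.isZmodMorphism.Build R S idz_in idz_in_zmod.
HB.instance Definition _ := GRing.isMonoidMorphism.Build R S idz_in idz_in_monoid.

Lemma idz_contrE (J : {pred S}) a : (a \in idz_contr J) = (idz_in a \in J).
Proof. by []. Qed.

Lemma fin_gen_regular : fin_gen (predT : {pred R^o}).
Proof.
exists 1%N, (fun=> 1); split=> // x _; exists (fun=> x).
by rewrite big_ord1 regular_scaleE mulr1.
Qed.

Lemma fin_gen_idealization : fin_gen (predT : {pred S}).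
Proof.
have [n [g [_ gM]]] := hM.
exists n.+1, (fun i => if unlift ord0 i is Some j then (0, g j) else (1, 0)); split=> // -[a x] _.
have [c xE] := gM x isT.
exists (fun i => if unlift ord0 i is Some j then c j else a).
rewrite big_ord_recl unlift_none; under eq_bigr do rewrite liftK.
have -> : \sum_(i < n) c i *: ((0, g i) : S) = (0, x).
  rewrite xE; elim/big_rec2: _ => // i y _ _ ->.
  by congr pair; rewrite /= ?scaler0 ?addr0.
by congr pair; rewrite /= ?addr0 ?scaler0 ?add0r ?regular_scaleE ?mulr1.
Qed.

(** Ideals of [S] are [R]-submodules of the finitely generated [R]-module R ⊕ M. *)
Lemma noetherian_idealization : noetherian_ring S.
Proof.
move=> I; have [||A AP] := @submod_of R S (fun s => s \in I).
- exact: rpred0.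
- move=> a x y xI yI; apply: (@rpredD _ I) => //; rewrite idz_scaleE.
  exact: (@rpredZ _ _ I).
have [n [g [gA Ag]]] := fin_gen_sub hR fin_gen_idealization A.
exists n, g; split=> [i|x /AP /Ag[c ->]]; first exact/AP.
by exists (fun i => idz_in (c i)); apply: eq_bigr => i _; rewrite idz_scaleE.
Qed.

Lemma prime_idz (P : prime_idealr R) : exists Q : prime_idealr S, Q =i idz_max M P.
Proof.
have [||||Q QP] := @prime_of S (fun s => s.1 \in P).
- exact: rpred0.
- by rewrite idealr1.
- by move=> s t u tP uP; rewrite rpredD // idealMr.
- by move=> s t; rewrite [_ \in P]prime_idealrM => /orP.
by exists Q => s; apply/idP/idP => /QP.
Qed.

(** The elements (0, x) have square zero and so lie in every prime; [Q] is determined by its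
    contraction to [R]. *)
Lemma idz_prime (Q : prime_idealr S) : exists P : prime_idealr R, Q =i idz_max M P.
Proof.
have [||||P PP] := @prime_of R (fun a => idz_in a \in Q).
- by rewrite rmorph0 rpred0.
- by rewrite rmorph1 idealr1.
- by move=> a x y xQ yQ; rewrite rmorphD rmorphM rpredD // idealMr.
- by move=> a b; rewrite rmorphM prime_idealrM => /orP.
have nil (x : M) : ((0, x) : S) \in Q.
  have : ((0, x) : S) * (0, x) \in Q by rewrite idz_prodE mul0r !scale0r addr0 rpred0.
  by rewrite prime_idealrM orbb.
exists P => -[a x]; have -> : ((a, x) : S) = idz_in a + (0, x).
  by congr pair; rewrite /= ?addr0 ?add0r.
have -> : (idz_in a + (0, x) \in idz_max M P) = (a \in P) by rewrite inE /= addr0.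
apply/idP/idP => [axQ|/PP aQ].
  apply/PP.
  by have := rpredB axQ (nil x); rewrite addrK.
by apply: rpredD; [exact: aQ | exact: nil].
Qed.

Lemma dim_quot_idz (I : {pred R}) (J : {pred S}) :
    (forall P : prime_idealr R, {subset I <= P} <-> {subset J <= idz_max M P}) ->
  dim_quot I = dim_quot J.
Proof.
move=> IJ; apply/eqP; rewrite eq_le; apply/andP; split; apply/dim_quot_le;
  split; rewrite ?dim_quot_ge // => n [P [JP inc]]; apply: chain_le_dim.
- have /choice [Q QE] : forall i, exists Q : prime_idealr S, Q =i idz_max M (P i).
    by move=> i; apply: prime_idz.
  exists Q; split=> [i s sJ|i j /inc[sub nsub]]; first by rewrite QE; apply: (IJ _).1 sJ.
  split=> [s|QQ]; first by rewrite !QE; apply: sub.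
  by apply: nsub => a aP; have := QQ (idz_in a); rewrite !QE; apply.
have /choice [Q QE] : forall i, exists Q : prime_idealr R, P i =i idz_max M Q.
  by move=> i; apply: idz_prime.
exists Q; split=> [i|i j /inc[sub nsub]]; first by apply/IJ => s /(JP i); rewrite QE.
split=> [a aQ|QQ]; first by have := sub (idz_in a); rewrite !QE; apply.
by apply: nsub => s; rewrite !QE; apply: QQ.
Qed.

(* [(a, x) * (a, - x) = (a ^+ 2, 0)]. *)
Lemma idz_contr_sub (J : {pred S}) (P : prime_idealr R) :
    (forall s t : S, t \in J -> s * t \in J) ->
  {subset J <= idz_max M P} <-> {subset idz_contr J <= P}.
Proof.
move=> JM; split=> [JP a aJ|JP [a x] axJ]; first exact: (JP (a, 0)).
have : a * a \in P.
  apply: JP; rewrite inE; have /= := JM (a, - x) _ axJ.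
  by rewrite idz_prodE scalerN addrN.
by rewrite prime_idealrM orbb.
Qed.

Lemma dim_quot_contr (J : {pred S}) : (forall s t : S, t \in J -> s * t \in J) ->
  dim_quot (idz_contr J) = dim_quot J.
Proof. by move=> JM; apply: dim_quot_idz => P; rewrite idz_contr_sub. Qed.

Lemma dim_quot_eq (I J : {pred R}) : I =i J -> dim_quot I = dim_quot J.
Proof. by move=> IJ; apply/eqP; rewrite eq_le !dim_quot_subset // => a; rewrite IJ. Qed.

Lemma dim_ann1_idz (s : S) : dim_quot (ann1 (s : S^o)) = dim_quot (ann1 s).
Proof.
rewrite -dim_quot_contr; last first.
  by move=> t u /eqP us; apply/eqP; rewrite -scalerA us scaler0.
by apply: dim_quot_eq => a; rewrite !inE idz_scaleE.
Qed.

(** The images of generators of [m] need not generate m ⊕ M, but (a, z)^2 = (a, 2z)(a, 0). Hence a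
    power of (a, z) kills [v] once a power of (a, 0) does, with twice the exponent. *)
Lemma torsion_idz (xs : seq R) :
    {subset xs <= m} ->
    (forall (V : lmodType R) (v : V), v \in torsion m V <-> tors xs v) ->
  forall (V : lmodType S) (v : V),
    v \in torsion (idz_max M m) V <-> tors [seq idz_in x | x <- xs] v.
Proof.
move=> xsm xsP V v; have [ys [ysn ysP]] := torsion_tors noetherian_idealization (idz_max M m).
split=> [tv _ /mapP[x /xsm xm ->]|tv]; first exact: torsion_exp tv.
apply/ysP => -[a z] /ysn am.
have /xsP tRv : tors xs (v : restr idz_in V) by apply/tors_restr.
have [k] := @torsion_exp R m (restr idz_in V) v a am tRv; rewrite restr_scaleE => kv.
exists (2 * k)%N; rewrite exprM.
have -> : ((a, z) : S) ^+ 2 = ((a, z + z) : S) * idz_in a.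
  by rewrite expr2 !idz_prodE scaler0 add0r scalerDr.
by rewrite exprMn -scalerA -rmorphXn kv scaler0.
Qed.

(** Annihilators over [S] contract to annihilators over [R], for the modules as for their local
    cohomology. By [idz_contr_sub] contraction keeps track of the primes above an ideal, on which
    both dimensions depend. *)
Lemma dimCM_idz (k : int) (N' : lmodType R) (N : lmodType S) (phi : N' -> N) :
    (forall a x y, phi (a *: x + y) = idz_in a *: phi x + phi y) ->
    injective phi -> (forall y, exists x, phi x = y) ->
  dimCM m k N' <-> dimCM (idz_max M m) k N.
Proof.
move=> phiL phi_inj phi_surj.
have phi0 : phi 0 = 0.
  by have := phiL (-1) 0 0; rewrite scaler0 addr0 rmorphN1 scaleN1r addNr.
have phiZ a x : phi (a *: x) = idz_in a *: phi x.
  by have := phiL a x 0; rewrite !addr0 phi0 addr0.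
have dE : int_dim N' = int_dim N.
  suff dE : dim_mod (predT : {pred N'}) = dim_mod (predT : {pred N}) by rewrite /int_dim dE.
  rewrite /dim_mod -dim_quot_contr; last first.
    by move=> s t /asboolP tN; apply/asboolP => x _; rewrite -scalerA tN ?scaler0.
  apply: dim_quot_eq => a; apply/asboolP/asboolP => aN x _.
    by have [y <-] := phi_surj x; rewrite -[(a, 0)]/(idz_in a) -phiZ aN.
  by apply: phi_inj; rewrite phiZ phi0 aN.
have [xs [xsm xsP]] := torsion_tors hR m.
have lcE := lc_ann_base_change hR noetherian_idealization xsP (torsion_idz xsm xsP)
  phiL phi_inj phi_surj.
rewrite /dimCM; suff -> : dim_quot (lc_ann_prod m N') =
    dim_quot (lc_ann_prod (idz_max M m) N) by [].
apply: dim_quot_idz => P; have [Q QE] := prime_idz P.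
have subQ (K : {pred S}) : {subset K <= idz_max M P} <-> {subset K <= Q}.
  by split=> KP s /KP; rewrite QE.
have lcP i : {subset lc_ann m N' i <= P} <-> {subset lc_ann (idz_max M m) N i <= Q}.
  rewrite -subQ idz_contr_sub; last by move=> s t; apply: lc_annM.
  split=> sub a aN; apply: sub.
    by apply/lcE; rewrite -idz_contrE.
  by rewrite idz_contrE; apply/lcE.
rewrite subQ !prime_lc_ann_prod dE.
by split=> -[i [id iP]]; exists i; split=> //; apply/lcP.
Qed.

Lemma strata_idz (k : int) :
  strata_dimCM (idz_max M m) k S^o <-> strata_dimCM m k (idealization M).
Proof.
suff main e (A B : submodClosed S^o) (A' B' : submodClosed (idealization M)) :
    (0%:E < e)%E ->
    (forall w, w \in A <-> (dim_quot (ann1 w) <= e)%E) ->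
    (forall w, w \in B <-> (dim_quot (ann1 w) < e)%E) ->
    (forall w, w \in A' <-> (dim_quot (ann1 w) <= e)%E) ->
    (forall w, w \in B' <-> (dim_quot (ann1 w) < e)%E) ->
    dimCM m k (subquot A' B') <-> dimCM (idz_max M m) k (subquot A B).
  split=> H e e0.
    move=> A' B' A'P B'P; have e1 : ((-1)%:E < e)%E by apply: lt_trans e0.
    have [A AP] := dim_ann1_le_sub S^o (ltW e1); have [B BP] := dim_ann1_lt_sub S^o e1.
    exact: (main e A B A' B' e0 AP BP A'P B'P).2 (H e e0 A B AP BP).
  move=> A B AP BP; have e1 : ((-1)%:E < e)%E by apply: lt_trans e0.
  have [A' A'P] := dim_ann1_le_sub (idealization M) (ltW e1).
  have [B' B'P] := dim_ann1_lt_sub (idealization M) e1.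
  exact: (main e A B A' B' e0 AP BP A'P B'P).1 (H e e0 A' B' A'P B'P).
move=> e0 AP BP A'P B'P.
have AE (s : S) : s \in A' <-> s \in A by rewrite A'P AP dim_ann1_idz.
have BE (s : S) : s \in B' <-> s \in B by rewrite B'P BP dim_ann1_idz.
have [||||phi [phiL phi_inj phi_surj]] :=
  @subquot_transfer R S idz_in (idealization M) S^o id A' B' A B.
- by move=> a x y; rewrite idz_scaleE.
- by move=> s /AE.
- by move=> s /AE sA; exists s.
- by move=> s _; apply: BE.
exact: dimCM_idz phiL phi_inj phi_surj.
Qed.

End IdealizationBaseChange.

Theorem corollary3p5 (R : comNzRingType) (m : idealr R) (M : lmodType R)
    (hR : noetherian_ring R) (hm : local_ring m)
    (hM : fin_gen (predT : {pred M})) :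
  [/\ (seqCM (idz_max M m) (idealization M)^o <-> seqCM m (idealization M)) /\
      (seqCM m (idealization M) <-> seqCM m R^o /\ seqCM m M),
      (seq_generalizedCM (idz_max M m) (idealization M)^o <->
        seq_generalizedCM m (idealization M)) /\
      (seq_generalizedCM m (idealization M) <->
        seq_generalizedCM m R^o /\ seq_generalizedCM m M) &
      (seq_1CM (idz_max M m) (idealization M)^o <-> seq_1CM m (idealization M)) /\
      (seq_1CM m (idealization M) <-> seq_1CM m R^o /\ seq_1CM m M)].
Proof.
have hS := noetherian_idealization hR hM.
suff main k : -1 <= k ->
    (seq_dimCM (idz_max M m) k (idealization M)^o <-> seq_dimCM m k (idealization M)) /\
    (seq_dimCM m k (idealization M) <-> seq_dimCM m k R^o /\ seq_dimCM m k M).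
  by split; apply: main.
move=> k1; have fgR := fin_gen_regular R; have fgS := fin_gen_idealization hM.
have hn := idz_local M hm.
rewrite (seq_dimCM_strata hS hn (fin_gen_regular _) k1) (seq_dimCM_strata hR hm fgS k1).
rewrite (seq_dimCM_strata hR hm fgR k1) (seq_dimCM_strata hR hm hM k1).
split; first exact: strata_idz.
(* As an [R]-module the idealization is by definition the product of [R^o] and [M]. *)
exact: (strata_pair hR m k1 fgR hM fgS).
Qed.
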